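(* Let $\infty\text{-}\mathrm{Gpd}_{sc}$ be the category of simply connected strict $\infty$-groupoids, $\infty\text{-}\mathrm{Gpd}_{\ge 2}$ the category of $1$-reduced strict $\infty$-groupoids, and $D_{\ge 2}(\mathrm{Ab})$ the derived category of abelian groups in homological degrees $\ge 2$. There is a canonical zigzag of equivalences of categories $$\mathrm{Ho}(\infty\text{-}\mathrm{Gpd}_{sc}) \longleftarrow \mathrm{Ho}(\infty\text{-}\mathrm{Gpd}_{\ge 2}) \longrightarrow D_{\ge 2}(\mathrm{Ab}),$$ in which the left functor is induced by the inclusion $\infty\text{-}\mathrm{Gpd}_{\ge 2}\hookrightarrow \infty\text{-}\mathrm{Gpd}_{sc}$ and the right functor is induced by the canonical equivalence $\infty\text{-}\mathrm{Gpd}_{\ge 2}\to C_{\ge 2}(\mathrm{Ab})$, a quasi-inverse of the equivalence $UK: C_{\ge 2}(\mathrm{Ab}) \to \infty\text{-}\mathrm{Gpd}_{\ge 2}$ described in the context.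
   Context: Strict $\infty$-categories and $\infty$-groupoids. A strict $\infty$-category $X$ consists of sets $X_i$ ($i\ge 0$) of $i$-arrows (objects are $0$-arrows), maps $s_i,t_i:X_i\to X_{i-1}$ ($i\ge1$; source and target) with $s_is_{i+1}=s_it_{i+1}$ and $t_is_{i+1}=t_it_{i+1}$, maps $k_i:X_i\to X_{i+1}$ (units), and, for $i>j\ge0$, compositions $*^i_j$ defined on pairs $(v,u)\in X_i\times X_i$ with $s^i_j(v)=t^i_j(u)$ and with values in $X_i$; here $s^i_j=s_{j+1}\cdots s_i$, $t^i_j=t_{j+1}\cdots t_i$, $k^i_j=k_{i-1}\cdots k_j:X_j\to X_i$. Axioms: $s_i(v*^i_ju)$ is $s_i(u)$ if $j=i-1$ and $s_i(v)*^{i-1}_js_i(u)$ if $j<i-1$; $t_i(v*^i_ju)$ is $t_i(v)$ if $j=i-1$ and $t_i(v)*^{i-1}_jt_i(u)$ if $j<i-1$; $s_{i+1}k_i(u)=u=t_{i+1}k_i(u)$; each $*^i_j$ is associative; exchange law $(\delta *^i_j\gamma)*^i_k(\beta*^i_j\alpha)=(\delta*^i_k\beta)*^i_j(\gamma*^i_k\alpha)$ for $i>j>k\ge0$ when $s^i_j\delta=t^i_j\gamma$, $s^i_k\gamma=t^i_k\beta$, $s^i_j\beta=t^i_j\alpha$; units $u*^i_jk^i_js^i_j(u)=u=k^i_jt^i_j(u)*^i_ju$; and $k_i(v*^i_ju)=k_i(v)*^{i+1}_jk_i(u)$. Morphisms preserve all structure. $X$ is a strict $\infty$-groupoid if for all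 $i>j\ge0$ every $i$-arrow $u$ has a $*^i_j$-inverse, i.e. an $i$-arrow $v$ with $s^i_j(v)=t^i_j(u)$, $t^i_j(v)=s^i_j(u)$, $u*^i_jv=k^i_jt^i_j(u)$, $v*^i_ju=k^i_js^i_j(u)$. Homotopy groups and weak equivalences. Two $n$-arrows $u,v$ of a strict $\infty$-groupoid $G$ are homotopic if there is an $(n+1)$-arrow $u\to v$; this is an equivalence relation. $\pi_0(G)$, the set of connected components, is the set of objects modulo homotopy; for $n\ge1$ and an object $x$, $\pi_n(G,x)$ is the group, under $*^n_{n-1}$, of $n$-arrows $k^{n-1}_0(x)\to k^{n-1}_0(x)$ modulo homotopy. A morphism $f:G\to H$ is a weak equivalence if it induces a bijection on $\pi_0$ and isomorphisms $\pi_n(G,x)\to\pi_n(H,f(x))$ for all $n\ge1$ and all objects $x$ of $G$. $G$ is connected if it has at most one connected component, and simply connected if it is connected and $\pi_1(G,x)$ is trivial for every object $x$. $G$ is $1$-reduced if it has exactly one object and exactly one $1$-arrow. $\infty\text{-}\mathrm{Gpd}_{sc}$ and $\infty\text{-}\mathrm{Gpd}_{\ge2}$ are the corresponding full subcategories of the category of strict $\infty$-groupoids. $\mathrm{Ho}(-)$ denotes the Gabriel–Zisman localization at the weak equivalences. $C_{\ge2}(\mathrm{Ab})$ is the category of homological chain complexes of abelian groups concentrated in degrees $\ge2$, and $D_{\ge2}(\mathrm{Ab})$ is its localization at quasi-isomorphisms. For a chain complex $(C,d)$ in degrees $\ge0$, $K(C)$ is the strict $\infty$-groupoid object in abelian groups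 with $K(C)_i=C_i\oplus C_{i-1}\oplus\cdots\oplus C_0$, $s_i(x_i,\dots,x_0)=(x_{i-1},\dots,x_0)$, $t_i(x_i,\dots,x_0)=(d_i(x_i)+x_{i-1},x_{i-2},\dots,x_0)$, $k_i(x_i,\dots,x_0)=(0,x_i,\dots,x_0)$, and $(x_i,\dots,x_0)*^i_j(y_i,\dots,y_0)=(x_i+y_i,\dots,x_{j+1}+y_{j+1},y_j,\dots,y_0)$; $K$ is functorial in the evident way. $U$ forgets the abelian group structures. The functor $UK$ restricts to a functor $C_{\ge 2}(\mathrm{Ab})\to\infty\text{-}\mathrm{Gpd}_{\ge2}$.
   Formalization: The category of simply connected strict ∞-groupoids is taken to consist of the nonempty ones; with ''at most one connected component'' the empty groupoid would be simply connected but not isomorphic in the homotopy category to any 1-reduced one, so the literal claim fails. *)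

(* Defs.v *)
From Corelib Require Import RelationClasses.
From HB Require Import structures.
From mathcomp Require Import all_boot all_algebra.

Set Implicit Arguments.
Unset Strict Implicit.
Unset Printing Implicit Defensive.

Import GRing.Theory.

(* Hom-sets are setoids: [heq] is the equality of parallel morphisms.  No
   equality of objects is ever used. *)

Record category := Category {
  obj :> Type;
  hom : obj -> obj -> Type;
  heq : forall x y, hom x y -> hom x y -> Prop;
  idm : forall x, hom x x;
  cmp : forall x y z, hom y z -> hom x y -> hom x z;
  heq_equiv : forall x y, Equivalence (@heq x y);
  cmp_heq : forall x y z (g g' : hom y z) (f f' : hom x y),
    heq g g' -> heq f f' -> heq (cmp g f) (cmp g' f');
  cmp1m : forall x y (f : hom x y), heq (cmp (idm y) f) f;
  cmpm1 : forall x y (f : hom x y), heq (cmp f (idm x)) f;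
  cmpA : forall x y z w (h : hom z w) (g : hom y z) (f : hom x y),
    heq (cmp h (cmp g f)) (cmp (cmp h g) f)
}.
Arguments hom {c} x y.
Arguments heq {c x y} f g.
Arguments idm {c} x.
Arguments cmp {c x y z} g f.

Definition invertible (C : category) (x y : C) (f : hom x y) : Prop :=
  exists g : hom y x, heq (cmp g f) (idm x) /\ heq (cmp f g) (idm y).

Record functor (C D : category) := Functor {
  fobj :> C -> D;
  fmor : forall x y, hom x y -> hom (fobj x) (fobj y);
  fmor_heq : forall x y (f g : hom x y), heq f g -> heq (fmor f) (fmor g);
  fmor1 : forall x, heq (fmor (idm x)) (idm (fobj x));
  fmorM : forall x y z (g : hom y z) (f : hom x y),
    heq (fmor (cmp g f)) (cmp (fmor g) (fmor f))
}.
Arguments fmor {C D} f0 {x y} f : rename.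

Definition functor_id (C : category) : functor C C.
Proof.
exists id (fun _ _ f => f) => //.
- by move=> x; case: (heq_equiv x x).
- by move=> x y z g f; case: (heq_equiv x z).
Defined.

Definition functor_comp (C D E : category) (G : functor D E) (F : functor C D) :
  functor C E.
Proof.
exists (fun x => G (F x)) (fun _ _ f => fmor G (fmor F f)).
- by move=> x y f g fg; do 2!apply: fmor_heq.
- move=> x; case: (heq_equiv (G (F x)) (G (F x))) => _ _ tr.
  by apply: tr (fmor1 _ _); apply: fmor_heq (fmor1 _ _).
- move=> x y z g f; case: (heq_equiv (G (F x)) (G (F z))) => _ _ tr.
  by apply: tr (fmorM _ _ _); apply: fmor_heq (fmorM _ _ _).
Defined.

Definition isomorphic_functors (C D : category) (F G : functor C D) : Prop :=
  exists eta : forall x, hom (F x) (G x),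
    (forall x y (f : hom x y),
       heq (cmp (eta y) (fmor F f)) (cmp (fmor G f) (eta x))) /\
    (forall x, invertible (eta x)).

Definition quasi_inverse (C D : category) (F : functor C D) (G : functor D C) :
    Prop :=
  isomorphic_functors (functor_comp G F) (functor_id C) /\
  isomorphic_functors (functor_comp F G) (functor_id D).

Definition is_equivalence (C D : category) (F : functor C D) : Prop :=
  exists G : functor D C, quasi_inverse F G.

Definition full_sub (C : category) (P : C -> Prop) : category.
Proof.
exists {x : C | P x} (fun x y => hom (sval x) (sval y))
  (fun _ _ f g => heq f g) (fun x => idm (sval x))
  (fun _ _ _ g f => cmp g f).
- by move=> x y; apply: heq_equiv.
- by move=> x y z; apply: cmp_heq.
- by move=> x y; apply: cmp1m.
- by move=> x y; apply: cmpm1.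
- by move=> x y z w; apply: cmpA.
Defined.

Definition full_sub_incl (C : category) (P Q : C -> Prop)
    (PQ : forall x, P x -> Q x) : functor (full_sub P) (full_sub Q).
Proof.
exists (fun x : full_sub P =>
          exist Q (sval x) (PQ _ (proj2_sig x)) : full_sub Q)
       (fun _ _ f => f) => //=.
- by move=> x; case: (heq_equiv (sval x) (sval x)).
- by move=> x y z g f; case: (heq_equiv (sval x) (sval z)).
Defined.

Definition full_sub_functor (C D : category) (F : functor C D)
    (P : C -> Prop) (Q : D -> Prop) (PQ : forall x, P x -> Q (F x)) :
  functor (full_sub P) (full_sub Q).
Proof.
exists (fun x : full_sub P =>
          exist Q (F (sval x)) (PQ _ (proj2_sig x)) : full_sub Q)
       (fun x y f => @fmor C D F (sval x) (sval y) f) => /=.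
- by move=> x y f g; apply: fmor_heq.
- by move=> x; apply: fmor1.
- by move=> x y z g f; apply: fmorM.
Defined.

(* Gabriel-Zisman localization: [loc C W] has the objects of [C]; its morphisms
   are presented by the morphisms of [C] and formal inverses of those in [W],
   and their equality is the smallest congruence making [loc_in] a functor and
   [loc_inv w] inverse to [loc_in w]. *)

Definition mclass (C : category) := forall x y : C, hom x y -> Prop.

Inductive loc_hom (C : category) (W : mclass C) : C -> C -> Type :=
| loc_in x y of hom x y : loc_hom W x y
| loc_inv x y (w : hom x y) of W x y w : loc_hom W y x
| loc_cmp x y z of loc_hom W y z & loc_hom W x y : loc_hom W x z.
Arguments loc_in {C} W {x y} f.
Arguments loc_inv {C W x y} w Ww.
Arguments loc_cmp {C W x y z} g f.

Inductive loc_eq (C : category) (W : mclass C) :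
    forall x y : C, loc_hom W x y -> loc_hom W x y -> Prop :=
| loc_refl x y (f : loc_hom W x y) : loc_eq f f
| loc_sym x y (f g : loc_hom W x y) : loc_eq f g -> loc_eq g f
| loc_trans x y (f g h : loc_hom W x y) :
    loc_eq f g -> loc_eq g h -> loc_eq f h
| loc_cmp_eq x y z (g g' : loc_hom W y z) (f f' : loc_hom W x y) :
    loc_eq g g' -> loc_eq f f' -> loc_eq (loc_cmp g f) (loc_cmp g' f')
| loc_cmp1m x y (f : loc_hom W x y) : loc_eq (loc_cmp (loc_in W (idm y)) f) f
| loc_cmpm1 x y (f : loc_hom W x y) : loc_eq (loc_cmp f (loc_in W (idm x))) f
| loc_cmpA x y z t (h : loc_hom W z t) (g : loc_hom W y z)
    (f : loc_hom W x y) :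
    loc_eq (loc_cmp h (loc_cmp g f)) (loc_cmp (loc_cmp h g) f)
| loc_in_eq x y (f g : hom x y) : heq f g -> loc_eq (loc_in W f) (loc_in W g)
| loc_in_cmp x y z (g : hom y z) (f : hom x y) :
    loc_eq (loc_in W (cmp g f)) (loc_cmp (loc_in W g) (loc_in W f))
| loc_invl x y (w : hom x y) (Ww : W x y w) :
    loc_eq (loc_cmp (loc_inv w Ww) (loc_in W w)) (loc_in W (idm x))
| loc_invr x y (w : hom x y) (Ww : W x y w) :
    loc_eq (loc_cmp (loc_in W w) (loc_inv w Ww)) (loc_in W (idm y)).

Definition loc (C : category) (W : mclass C) : category.
Proof.
exists (obj C) (@loc_hom C W) (@loc_eq C W) (fun x => loc_in W (idm x))
  (fun _ _ _ g f => loc_cmp g f).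
- move=> x y; split.
  + by move=> f; apply: loc_refl.
  + by move=> f g; apply: loc_sym.
  + by move=> f g h; apply: loc_trans.
- by move=> x y z g g' f f'; apply: loc_cmp_eq.
- by move=> x y f; apply: loc_cmp1m.
- by move=> x y f; apply: loc_cmpm1.
- by move=> x y z w h g f; apply: loc_cmpA.
Defined.

Definition preserves (C D : category) (W : mclass C) (V : mclass D)
    (F : functor C D) : Prop :=
  forall x y (f : hom x y), W x y f -> V _ _ (fmor F f).

Fixpoint loc_fmor (C D : category) (W : mclass C) (V : mclass D)
    (F : functor C D) (FW : preserves W V F) (x y : C) (f : loc_hom W x y) :
    loc_hom V (F x) (F y) :=
  match f with
  | loc_in _ _ f => loc_in V (fmor F f)
  | loc_inv _ _ w Ww => loc_inv (fmor F w) (FW _ _ w Ww)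
  | loc_cmp _ _ _ g f => loc_cmp (loc_fmor FW g) (loc_fmor FW f)
  end.

(* The functor induced between localizations: the one that commutes, on the
   nose, with the localization functors. *)
Definition loc_functor (C D : category) (W : mclass C) (V : mclass D)
    (F : functor C D) (FW : preserves W V F) : functor (loc W) (loc V).
Proof.
exists (fun x : loc W => F x : loc V) (fun x y f => loc_fmor FW f).
- move=> x y f g; elim=> {x y f g} /=.
  + by move=> *; apply: loc_refl.
  + by move=> x y f g _; apply: loc_sym.
  + by move=> x y f g h _ fg _; apply: loc_trans fg.
  + by move=> x y z g g' f f' _ gg' _; apply: loc_cmp_eq.
  + move=> x y f; apply: loc_trans (loc_cmp1m _).
    by apply: loc_cmp_eq (loc_refl _); apply: loc_in_eq (fmor1 _ _).
  + move=> x y f; apply: loc_trans (loc_cmpm1 _).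
    by apply: loc_cmp_eq (loc_refl _) _; apply: loc_in_eq (fmor1 _ _).
  + by move=> *; apply: loc_cmpA.
  + by move=> x y f g fg; apply/loc_in_eq/fmor_heq.
  + move=> x y z g f; apply: loc_trans (loc_in_cmp _ _ _).
    by apply: loc_in_eq (fmorM _ _ _).
  + move=> x y w Ww; apply: loc_trans (loc_invl _) _.
    by apply: loc_sym; apply: loc_in_eq (fmor1 _ _).
  + move=> x y w Ww; apply: loc_trans (loc_invr _) _.
    by apply: loc_sym; apply: loc_in_eq (fmor1 _ _).
- by move=> x; apply: loc_in_eq (fmor1 _ _).
- by move=> x y z g f; apply: loc_refl.
Defined.

(* A quotient set is represented by a setoid, a quotient group by a group law
   on a setoid. *)
Record setoid := Setoid {
  scar :> Type;
  seqv : scar -> scar -> Prop;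
  seqv_equiv : Equivalence seqv
}.
Arguments seqv {s} x y.

Definition is_bijection (A B : setoid) (f : A -> B) : Prop :=
  [/\ forall x y, seqv x y -> seqv (f x) (f y),
      forall x y, seqv (f x) (f y) -> seqv x y
    & forall z, exists x, seqv (f x) z].

Record sgroup := SGroup {
  gset :> setoid;
  gmul : gset -> gset -> gset;
  gone : gset;
  gmul_eqv : forall a a' b b' : gset,
    seqv a a' -> seqv b b' -> seqv (gmul a b) (gmul a' b');
  gmulA : forall a b c, seqv (gmul (gmul a b) c) (gmul a (gmul b c));
  gmul1 : forall a, seqv (gmul gone a) a /\ seqv (gmul a gone) a;
  gmulV : forall a, exists b, seqv (gmul b a) gone /\ seqv (gmul a b) gone
}.

Definition is_group_iso (A B : sgroup) (f : A -> B) : Prop :=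
  is_bijection f /\ forall x y, seqv (f (gmul x y)) (gmul (f x) (f y)).

(* [move dn up i j : X i -> X j] iterates [dn] if [j <= i] and [up] if
   [i <= j] (see [move_id], [move_dn], [move_up]); it lets [s^i_j], [t^i_j] and
   [k^i_j] be written for all [i] and [j] without transport along equalities of
   indices. *)
Fixpoint up0 (X : nat -> Type) (up : forall n, X n -> X n.+1) (j : nat) :
    X 0 -> X j :=
  match j with
  | 0 => fun x => x
  | j'.+1 => fun x => up j' (up0 up j' x)
  end.

Fixpoint move (X : nat -> Type) (dn : forall n, X n.+1 -> X n)
    (up : forall n, X n -> X n.+1) (i j : nat) {struct i} : X i -> X j :=
  match i, j return X i -> X j with
  | 0, j => up0 up j
  | i'.+1, 0 => fun x => @move X dn up i' 0 (dn i' x)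
  | i'.+1, j'.+1 =>
      @move (fun n => X n.+1) (fun n => dn n.+1) (fun n => up n.+1) i' j'
  end.

Arguments move {X} dn up i j x.

Lemma move_id X dn up i x : @move X dn up i i x = x.
Proof. by elim: i X dn up x => [|i IH] X dn up x //=; rewrite IH. Qed.

Lemma move_dn X dn up i j x : j <= i ->
  @move X dn up i.+1 j x = move dn up i j (dn i x).
Proof.
elim: i X dn up j x => [|i IH] X dn up [|j] x //= lji.
exact: (IH (fun n => X n.+1)).
Qed.

Lemma move_up X dn up i j x : j <= i ->
  @move X dn up j i.+1 x = up i (move dn up j i x).
Proof.
elim: j X dn up i x => [|j IH] X dn up [|i] x //= lji.
exact: (IH (fun n => X n.+1)).
Qed.

(* [comp j v u], for [v u : cell i], is v *^i_j u.  It is a total function whose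
   values are irrelevant unless [j < i] and [composable j v u]: neither the
   axioms nor the morphisms constrain the other ones. *)
Record ocat := OCat {
  cell :> nat -> Type;
  src : forall i, cell i.+1 -> cell i;
  tgt : forall i, cell i.+1 -> cell i;
  unt : forall i, cell i -> cell i.+1;
  comp : forall i (j : nat), cell i -> cell i -> cell i;
  (* the iterated maps s^i_j, t^i_j and k^i_j *)
  srcs := move src unt : forall i j, cell i -> cell j;
  tgts := move tgt unt : forall i j, cell i -> cell j;
  unts := (fun i j => move src unt j i) : forall i j, cell j -> cell i;
  composable := fun i j (v u : cell i) => srcs j v = tgts j u;
  src_src : forall i (u : cell i.+2), src (src u) = src (tgt u);
  tgt_src : forall i (u : cell i.+2), tgt (src u) = tgt (tgt u);
  src_comp_top : forall j (v u : cell j.+1), composable j v u ->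
    src (comp j v u) = src u;
  src_comp : forall i j (v u : cell i.+1), j < i -> composable j v u ->
    src (comp j v u) = comp j (src v) (src u);
  tgt_comp_top : forall j (v u : cell j.+1), composable j v u ->
    tgt (comp j v u) = tgt v;
  tgt_comp : forall i j (v u : cell i.+1), j < i -> composable j v u ->
    tgt (comp j v u) = comp j (tgt v) (tgt u);
  src_unt : forall i (u : cell i), src (unt u) = u;
  tgt_unt : forall i (u : cell i), tgt (unt u) = u;
  compA : forall i j (w v u : cell i), j < i ->
    composable j w v -> composable j v u ->
    comp j (comp j w v) u = comp j w (comp j v u);
  exchange : forall i j k (d c b a : cell i), k < j -> j < i ->
    composable j d c -> composable k c b -> composable j b a ->
    comp k (comp j d c) (comp j b a) = comp j (comp k d b) (comp k c a);
  comp_unts : forall i j (u : cell i), j < i ->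
    comp j u (unts i (srcs j u)) = u;
  unts_comp : forall i j (u : cell i), j < i ->
    comp j (unts i (tgts j u)) u = u;
  unt_comp : forall i j (v u : cell i), j < i -> composable j v u ->
    unt (comp j v u) = comp j (unt v) (unt u)
}.
Arguments src {o i} u.
Arguments tgt {o i} u.
Arguments unt {o i} u.
Arguments comp {o i} j v u.
Arguments srcs {o i} j u.
Arguments tgts {o i} j u.
Arguments unts {o} i {j} u.
Arguments composable {o i} j v u.

Record ofun (X Y : ocat) := OFun {
  ofn :> forall i, X i -> Y i;
  ofn_src : forall i (u : X i.+1), ofn (src u) = src (ofn u);
  ofn_tgt : forall i (u : X i.+1), ofn (tgt u) = tgt (ofn u);
  ofn_unt : forall i (u : X i), ofn (unt u) = unt (ofn u);
  ofn_comp : forall i j (v u : X i), j < i -> composable j v u ->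
    ofn (comp j v u) = comp j (ofn v) (ofn u)
}.
Arguments ofn {X Y} o {i} u.

Lemma ofn_move (X Y : nat -> Type) dnX upX dnY upY (f : forall i, X i -> Y i) :
  (forall i u, f i (dnX i u) = dnY i (f i.+1 u)) ->
  (forall i u, f i.+1 (upX i u) = upY i (f i u)) ->
  forall i j u, f j (@move X dnX upX i j u) = @move Y dnY upY i j (f i u).
Proof.
move=> fdn fup i; elim: i X Y dnX upX dnY upY f fdn fup => [|i IH] X Y dnX upX
  dnY upY f fdn fup j u /=.
  by elim: j => [|j IHj] //=; rewrite fup IHj.
case: j => [|j] /=; first by rewrite (IH _ _ _ _ _ _ f fdn fup) fdn.
exact: (IH (fun n => X n.+1) (fun n => Y n.+1) _ _ _ _ (fun n => f n.+1)).
Qed.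

Lemma ofn_srcs (X Y : ocat) (f : ofun X Y) i j (u : X i) :
  ofn f (srcs j u) = srcs j (ofn f u).
Proof. by apply: ofn_move; [apply: ofn_src | apply: ofn_unt]. Qed.

Lemma ofn_tgts (X Y : ocat) (f : ofun X Y) i j (u : X i) :
  ofn f (tgts j u) = tgts j (ofn f u).
Proof. by apply: ofn_move; [apply: ofn_tgt | apply: ofn_unt]. Qed.

Lemma ofn_unts (X Y : ocat) (f : ofun X Y) i j (u : X j) :
  ofn f (unts i u) = unts i (ofn f u).
Proof. by apply: ofn_move; [apply: ofn_src | apply: ofn_unt]. Qed.

Lemma ofn_composable (X Y : ocat) (f : ofun X Y) i j (v u : X i) :
  composable j v u -> composable j (ofn f v) (ofn f u).
Proof. by rewrite /composable -/(srcs _ _) -ofn_srcs -ofn_tgts => ->. Qed.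

Definition ofun_id (X : ocat) : ofun X X.
Proof. by exists (fun _ u => u). Defined.

Definition ofun_comp (X Y Z : ocat) (g : ofun Y Z) (f : ofun X Y) : ofun X Z.
Proof.
exists (fun _ u => ofn g (ofn f u)) => [i u|i u|i u|i j v u ji vu].
- by rewrite !ofn_src.
- by rewrite !ofn_tgt.
- by rewrite !ofn_unt.
- by rewrite !ofn_comp //; apply: ofn_composable.
Defined.

Definition oCat : category.
Proof.
exists ocat ofun
  (fun (X Y : ocat) (f g : ofun X Y) => forall i (u : X i), ofn f u = ofn g u)
  ofun_id ofun_comp => //.
- by move=> X Y; split=> [f|f g fg|f g h fg gh] i u //; rewrite fg.
- by move=> X Y Z g g' f f' gg' ff' i u /=; rewrite ff' gg'.
Defined.

Definition is_groupoid (X : ocat) : Prop :=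
  forall i j (u : X i), j < i -> exists v : X i,
    [/\ srcs j v = tgts j u,
        tgts j v = srcs j u,
        comp j u v = unts i (tgts j u)
      & comp j v u = unts i (srcs j u)].

Definition oGpd : category := full_sub (is_groupoid : oCat -> Prop).

Definition gcell (G : oGpd) : ocat := sval G.
Coercion gcell : obj >-> ocat.

Definition homotopic (X : ocat) n (u v : X n) : Prop :=
  exists a : X n.+1, src a = u /\ tgt a = v.

Lemma srcsS (X : ocat) n (u : X n.+1) : srcs n u = src u.
Proof. by rewrite /srcs move_dn // move_id. Qed.

Lemma tgtsS (X : ocat) n (u : X n.+1) : tgts n u = tgt u.
Proof. by rewrite /tgts move_dn // move_id. Qed.

Lemma untsS (X : ocat) n (u : X n) : unts n.+1 u = unt u.
Proof. by rewrite /unts move_up // move_id. Qed.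

Lemma composableS (X : ocat) n (v u : X n.+1) :
  src v = tgt u -> composable n v u.
Proof. by rewrite -srcsS -tgtsS. Qed.

Lemma composableSS (X : ocat) n (v u : X n.+2) :
  src (src v) = tgt (tgt u) -> composable n v u.
Proof. by rewrite /composable /srcs /tgts !move_dn // !move_id. Qed.

Lemma homotopic_equiv (G : oGpd) n : Equivalence (@homotopic G n).
Proof.
split.
- by move=> u; exists (unt u); rewrite src_unt tgt_unt.
- move=> u v [a [<- <-]]; case: (proj2_sig G _ n a (ltnSn n)) => b [].
  by rewrite !srcsS !tgtsS => sb tb _ _; exists b.
- move=> u v w [a [<- av]] [b [bv <-]].
  have ba : composable n b a by apply: composableS; rewrite av.
  by exists (comp n b a); rewrite src_comp_top // tgt_comp_top.
Qed.

Definition pi0 (G : oGpd) : setoid := Setoid (@homotopic_equiv G 0).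

(* [loops G m x] is the set of (m+1)-arrows k^m_0(x) -> k^m_0(x). *)
Definition loops (G : oGpd) (m : nat) (x : G 0) : Type :=
  {u : G m.+1 | src u = unts m x /\ tgt u = unts m x}.

Definition loops_setoid (G : oGpd) (m : nat) (x : G 0) : setoid.
Proof.
exists (loops m x) (fun u v => homotopic (sval u) (sval v)).
have [r s t] := @homotopic_equiv G m.+1.
by split=> [u|u v|u v w]; [apply: r | apply: s | apply: t].
Defined.

Definition loop_mul (G : oGpd) (m : nat) (x : G 0) (v u : loops m x) : loops m x.
Proof.
exists (comp m (sval v) (sval u)).
case: u v => [u [su tu]] [v [sv tv]] /=.
have vu : composable m v u by apply: composableS; rewrite sv.
by rewrite src_comp_top // tgt_comp_top.
Defined.

Definition loop_one (G : oGpd) (m : nat) (x : G 0) : loops m x.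
Proof. by exists (unt (unts m x)); rewrite src_unt tgt_unt. Defined.

(* The homotopy group [pi G m x] is the one of degree m + 1. *)
Definition pi (G : oGpd) (m : nat) (x : G 0) : sgroup.
Proof.
exists (loops_setoid m x) (@loop_mul G m x) (loop_one m x).
- move=> [u [su tu]] [u' [su' tu']] [v [sv tv]] [v' [sv' tv']].
  rewrite /homotopic /= => -[a [au au']] [b [bv bv']].
  have ab : composable m a b.
    by apply: composableSS; rewrite au bv' su tv'.
  by exists (comp m a b); rewrite src_comp // tgt_comp // au bv au' bv'.
- move=> [u [su tu]] [v [sv tv]] [w [sw tw]] /=.
  rewrite compA //; [|by apply: composableS; rewrite su..|].
  + by case: (homotopic_equiv G m.+1).
  + by apply: composableS; rewrite sv.
- have [r _ _] := homotopic_equiv G m.+1.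
  move=> [u [su tu]] /=; split.
  + have := unts_comp u (ltnSn m).
    by rewrite untsS tgtsS tu => ->; apply: r.
  + have := comp_unts u (ltnSn m).
    by rewrite untsS srcsS su => ->; apply: r.
- have [r _ _] := homotopic_equiv G m.+1.
  move=> [u [su tu]] /=; case: (proj2_sig G _ m u (ltnSn m)) => v [].
  rewrite !srcsS !tgtsS !untsS su tu => sv tv uv vu.
  exists (exist _ v (conj sv tv)) => /=.
  by split; [rewrite [comp _ _ _]vu | rewrite [comp _ _ _]uv]; apply: r.
Defined.

Definition pi_map (G H : oGpd) (f : hom G H) m (x : G 0) :
  pi m x -> pi m (ofn f x).
Proof.
move=> u; exists (ofn f (sval u)).
by case: u => u [su tu] /=; rewrite -ofn_src -ofn_tgt su tu ofn_unts.
Defined.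

Definition weak_equivalence (G H : oGpd) (f : hom G H) : Prop :=
  @is_bijection (pi0 G) (pi0 H) (@ofn G H f 0) /\
  forall m (x : G 0), is_group_iso (@pi_map G H f m x).

Definition connected (G : oGpd) : Prop := forall x y : pi0 G, seqv x y.

Definition simply_connected (G : oGpd) : Prop :=
  connected G /\ forall (x : G 0) (a b : pi 0 x), seqv a b.

Definition one_reduced (G : oGpd) : Prop :=
  (exists x : G 0, forall y, y = x) /\ (exists u : G 1, forall v, v = u).

(* The empty groupoid, which is [simply_connected], has to be left out: nothing
   1-reduced is isomorphic to it in the homotopy category. *)
Definition oGpd_sc : category :=
  full_sub (fun G : oGpd => inhabited (G 0) /\ simply_connected G).

Definition oGpd_ge2 : category := full_sub one_reduced.

Lemma one_reduced_sc (G : oGpd) :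
  one_reduced G -> inhabited (G 0) /\ simply_connected G.
Proof.
move=> [[x xP] [u uP]]; split=> //; split.
- by move=> a b; rewrite (xP a) (xP b); case: (seqv_equiv (pi0 G)).
- move=> y [a aP] [b bP] /=; rewrite /seqv /= (uP a) (uP b).
  by case: (homotopic_equiv G 1).
Qed.

Definition ge2_incl : functor oGpd_ge2 oGpd_sc := full_sub_incl one_reduced_sc.

Definition weq_sc : mclass oGpd_sc :=
  fun G H => @weak_equivalence (sval G) (sval H).

Definition weq_ge2 : mclass oGpd_ge2 :=
  fun G H => @weak_equivalence (sval G) (sval H).

Lemma ge2_incl_weq : preserves weq_ge2 weq_sc ge2_incl.
Proof. by []. Qed.

Local Open Scope ring_scope.

Record complex := Complex {
  chain :> nat -> zmodType;
  bd : forall n, {additive chain n.+1 -> chain n};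
  bd_bd : forall n x, bd n (bd n.+1 x) = 0
}.
Arguments bd {c n}.

Record cmap (C D : complex) := CMap {
  cfn :> forall n, {additive C n -> D n};
  cfn_bd : forall n (x : C n.+1), cfn n (bd x) = bd (cfn n.+1 x)
}.

Definition cmap_id (C : complex) : cmap C C.
Proof. by exists (fun n => idfun). Defined.

Definition cmap_comp (C D E : complex) (g : cmap D E) (f : cmap C D) : cmap C E.
Proof.
by exists (fun n => g n \o f n) => n x /=; rewrite !cfn_bd.
Defined.

Definition Ch : category.
Proof.
exists complex cmap
  (fun (C D : complex) (f g : cmap C D) => forall n (x : C n), f n x = g n x)
  cmap_id cmap_comp => //.
- by move=> C D; split=> [f|f g fg|f g h fg gh] n x //; rewrite fg.
- by move=> C D E g g' f f' gg' ff' n x /=; rewrite ff' gg'.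
Defined.

Definition in_degrees_ge2 (C : Ch) : Prop :=
  forall n, (n < 2)%N -> forall x : (C : complex) n, x = 0.

Definition Ch_ge2 : category := full_sub in_degrees_ge2.

Definition is_cycle (C : complex) n : C n -> Prop :=
  match n with 0 => fun _ => True | n'.+1 => fun x => bd x = 0 end.

Lemma is_cycle0 (C : complex) n : is_cycle (0 : C n).
Proof. by case: n => //= n; rewrite raddf0. Qed.

Lemma is_cycleD (C : complex) n (x y : C n) :
  is_cycle x -> is_cycle y -> is_cycle (x + y).
Proof. by case: n x y => //= n x y dx dy; rewrite raddfD /= dx dy addr0. Qed.

Lemma is_cycleN (C : complex) n (x : C n) : is_cycle x -> is_cycle (- x).
Proof. by case: n x => //= n x dx; rewrite raddfN /= dx oppr0. Qed.

Definition cycles (C : complex) n : Type := {x : C n | is_cycle x}.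

Definition homologous (C : complex) n (x y : cycles C n) : Prop :=
  exists z : C n.+1, sval x - sval y = bd z.

Lemma homologous_equiv (C : complex) n : Equivalence (@homologous C n).
Proof.
split.
- by move=> x; exists 0; rewrite subrr raddf0.
- by move=> x y [z e]; exists (- z); rewrite raddfN -e opprB.
- move=> x y t [z e] [w e']; exists (z + w).
  by rewrite raddfD -e -e' addrA subrK.
Qed.

Definition homology (C : complex) (n : nat) : sgroup.
Proof.
exists (Setoid (@homologous_equiv C n))
  (fun x y => exist _ (sval x + sval y) (is_cycleD (proj2_sig x) (proj2_sig y)))
  (exist _ 0 (is_cycle0 C n)).
- move=> a a' b b' [z e] [w e']; exists (z + w).
  by rewrite (raddfD bd) -e -e' /= opprD addrACA.
- by move=> a b c; exists 0; rewrite raddf0 /= addrA subrr.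
- by move=> a; split; exists 0; rewrite raddf0 /= ?add0r ?addr0 subrr.
- move=> a; exists (exist _ (- sval a) (is_cycleN (proj2_sig a))).
  by split; exists 0; rewrite raddf0 /= ?(addNr, subrr) ?subr0 ?subrr.
Defined.

Lemma is_cycle_cmap (C D : complex) (f : cmap C D) n (x : C n) :
  is_cycle x -> is_cycle (f n x).
Proof. by case: n x => //= n x dx; rewrite -cfn_bd dx raddf0. Qed.

Definition homology_map (C D : complex) (f : cmap C D) n
    (x : homology C n) : homology D n :=
  exist _ (f n (sval x)) (is_cycle_cmap f (proj2_sig x)).

Definition quasi_iso (C D : complex) (f : cmap C D) : Prop :=
  forall n, is_group_iso (@homology_map C D f n).

Definition qis_ge2 : mclass Ch_ge2 :=
  fun C D => @quasi_iso (sval C) (sval D).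

(* [Kcell C i] is C_i + (C_(i-1) + (... + C_0)). *)
Fixpoint Kcell (C : nat -> zmodType) (i : nat) : Type :=
  match i with 0 => C 0%N | i'.+1 => (C i'.+1 * Kcell C i')%type end.

(* adds an element of C_i to the component of degree i *)
Definition Kaddtop (C : nat -> zmodType) i (a : C i) : Kcell C i -> Kcell C i :=
  match i return C i -> Kcell C i -> Kcell C i with
  | 0 => fun a x => a + x
  | i'.+1 => fun a x => (a + x.1, x.2)
  end a.

Definition Ksrc (C : nat -> zmodType) i (x : Kcell C i.+1) : Kcell C i := x.2.

Definition Ktgt (C : complex) i (x : Kcell C i.+1) : Kcell C i :=
  Kaddtop (bd (x.1 : C i.+1)) x.2.

Definition Kunt (C : nat -> zmodType) i (x : Kcell C i) : Kcell C i.+1 := (0, x).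

(* the components of degree > j are added, the other ones are those of y *)
Fixpoint Kcomp (C : nat -> zmodType) (i j : nat) :
    Kcell C i -> Kcell C i -> Kcell C i :=
  match i return Kcell C i -> Kcell C i -> Kcell C i with
  | 0 => fun x y => y
  | i'.+1 => fun x y => (if (j < i'.+1)%N then x.1 + y.1 else y.1,
                         @Kcomp C i' j x.2 y.2)
  end.

Lemma Kaddtop0 (C : nat -> zmodType) i (x : Kcell C i) : Kaddtop 0 x = x.
Proof. by case: i x => [|i] x /=; rewrite add0r //; case: x. Qed.

Lemma KaddtopD (C : nat -> zmodType) i (a b : C i) (x : Kcell C i) :
  Kaddtop (a + b) x = Kaddtop a (Kaddtop b x).
Proof. by case: i a b x => [|i] a b x /=; rewrite addrA. Qed.

Lemma Kcomp_low (C : nat -> zmodType) i j (x y : Kcell C i) :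
  (i <= j)%N -> Kcomp j x y = y.
Proof.
elim: i x y => [|i IH] //= x [y1 y2] lij; rewrite IH ?(ltnW lij) //=.
by case: ifP => // ji; have := leq_trans ji lij; rewrite ltnn.
Qed.

Lemma Kcomp_top (C : nat -> zmodType) i j (a b : C i) (x y : Kcell C i) :
  (j < i)%N -> Kaddtop (a + b) (Kcomp j x y) =
               Kcomp j (Kaddtop a x) (Kaddtop b y).
Proof. by case: i a b x y => [|i] //= a b x y ->; rewrite addrACA. Qed.

Lemma Kcomp_comp (C : nat -> zmodType) i j k (d c b a : Kcell C i) :
  Kcomp k (Kcomp j d c) (Kcomp j b a) = Kcomp j (Kcomp k d b) (Kcomp k c a).
Proof.
elim: i d c b a => [|i IH] //= d c b a; rewrite IH.
by case: (j < i.+1)%N; case: (k < i.+1)%N; rewrite // addrACA.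
Qed.

Lemma KcompA (C : nat -> zmodType) i j (c b a : Kcell C i) :
  Kcomp j (Kcomp j c b) a = Kcomp j c (Kcomp j b a).
Proof.
elim: i c b a => [|i IH] //= c b a; rewrite IH.
by case: (j < i.+1)%N; rewrite ?addrA.
Qed.

Lemma Kcomp_unts (C : nat -> zmodType) i j (u : Kcell C i) : (j <= i)%N ->
  Kcomp j u (move (@Ksrc C) (@Kunt C) j i
              (move (@Ksrc C) (@Kunt C) i j u)) = u.
Proof.
elim: i u => [|i IH] u; first by case: j.
rewrite leq_eqVlt => /predU1P[->|ji]; first by rewrite !move_id Kcomp_low.
rewrite move_dn // move_up //= IH // addr0.
by case: u => a u; rewrite ji.
Qed.

Lemma Kunts_comp (C : nat -> zmodType) i j (y : Kcell C j) (u : Kcell C i) :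
  (j <= i)%N -> Kcomp j (move (@Ksrc C) (@Kunt C) j i y) u = u.
Proof.
elim: i u => [|i IH] u; first by case: j y.
rewrite leq_eqVlt => /predU1P[e|ji]; first by rewrite Kcomp_low // e.
by rewrite move_up //= IH // add0r ji; case: u.
Qed.

Lemma Ktgt_Kaddtop (C : complex) i (a : C i.+2) (x : Kcell C i.+1) :
  Ktgt (Kaddtop (bd a : C i.+1) x) = Ktgt x.
Proof. by rewrite /Ktgt /= raddfD /= bd_bd add0r. Qed.

Lemma Kmove_tgt (C : complex) i j (a : C i.+1) (x : Kcell C i) : (j < i)%N ->
  move (@Ktgt C) (@Kunt C) i j (Kaddtop (bd a : C i) x) =
  move (@Ktgt C) (@Kunt C) i j x.
Proof. by case: i a x => // i a x ji; rewrite !move_dn // Ktgt_Kaddtop. Qed.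

Definition UK_obj (C : complex) : ocat.
Proof.
apply: (@OCat (Kcell C) (@Ksrc C) (@Ktgt C) (@Kunt C) (@Kcomp C)).
- by [].
- by move=> i u; exact/esym/(Ktgt_Kaddtop (C := C) u.1).
- by move=> j v u _; rewrite /Ksrc /= Kcomp_low.
- by [].
- move=> j v u; rewrite !move_dn // !move_id /Ktgt /Ksrc /= => ->.
  by rewrite ltnSn Kcomp_low // raddfD KaddtopD.
- move=> i j v u ji _; rewrite /Ktgt /= ltnS (ltnW ji) raddfD.
  exact: Kcomp_top.
- by [].
- by move=> i u; rewrite /Ktgt /= raddf0 Kaddtop0.
- by move=> *; apply: KcompA.
- by move=> *; apply: Kcomp_comp.
- by move=> i j u ji; apply: Kcomp_unts (ltnW ji).
- by move=> i j u ji; apply: Kunts_comp (ltnW ji).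
- by move=> i j v u ji _; rewrite /Kunt /= addr0 if_same.
Defined.

Lemma UK_groupoid (C : complex) : is_groupoid (UK_obj C).
Proof.
move=> i j u /ltnW; rewrite /srcs /tgts /unts /=.
elim: i u => [|i IH] u; first by case: j => // _; exists u.
rewrite leq_eqVlt => /predU1P[->|ji].
  by exists u; split; rewrite ?move_id // Kcomp_low.
case: u => a u; move: (ji); rewrite leq_eqVlt => /predU1P[[e]|ji'].
  subst j; exists (- a, Kaddtop (bd a : C i) u).
  rewrite !move_dn // !move_up // !move_id /Ksrc /Ktgt /Kunt /= ltnSn.
  rewrite !Kcomp_low // addrN addNr -KaddtopD raddfN addNr Kaddtop0.
  by split.
have [v [sv tv uv vu]] := IH u (ltnW ji').
exists (- a, v); rewrite !move_dn // !move_up // /Ksrc /Ktgt /Kunt /=.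
rewrite !Kmove_tgt // ji addrN addNr sv tv.
by split=> //; [move: uv | move: vu] => /= ->.
Qed.

Fixpoint Kmap (C D : nat -> zmodType) (f : forall n, C n -> D n) (i : nat) :
    Kcell C i -> Kcell D i :=
  match i with
  | 0 => f 0%N
  | i'.+1 => fun x => (f i'.+1 x.1, @Kmap C D f i' x.2)
  end.

Definition UK_mor (C D : complex) (f : cmap C D) : ofun (UK_obj C) (UK_obj D).
Proof.
exists (Kmap (fun n => f n)).
- by [].
- move=> [|i] [a u]; rewrite /tgt /= /Ktgt /=.
  + by rewrite raddfD /= cfn_bd.
  + by rewrite raddfD /= cfn_bd.
- by move=> i u; rewrite /unt /= /Kunt raddf0.
- move=> i j v u _ _; elim: i v u => [|i IH] //= v u.
  by rewrite [Kmap _ _]IH; case: ifP => // _; rewrite raddfD.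
Defined.

Definition UK : functor Ch oGpd.
Proof.
exists (fun C : Ch => exist _ (UK_obj C) (@UK_groupoid C) : oGpd)
       (fun (C D : complex) (f : cmap C D) => UK_mor f).
- move=> C D f g fg i u /=; elim: i u => [|i IH] u /=; first exact: fg.
  by rewrite fg IH.
- by move=> C i u /=; elim: i u => [|i IH] //= u; rewrite IH; case: u.
- by move=> C D E g f i u /=; elim: i u => [|i IH] //= u; rewrite IH.
Defined.

Lemma UK_one_reduced (C : Ch) : in_degrees_ge2 C -> one_reduced (UK C).
Proof.
move=> C0; split; first by exists (0 : (C : complex) 0%N) => y; apply: C0.
exists (0 : (C : complex) 1%N, 0 : (C : complex) 0%N) => -[a b].
by congr pair; apply: C0.
Qed.

Definition UK_ge2 : functor Ch_ge2 oGpd_ge2 := full_sub_functor UK_one_reduced.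

Definition Ho_sc : category := loc weq_sc.
Definition Ho_ge2 : category := loc weq_ge2.
Definition D_ge2 : category := loc qis_ge2.

(* Main.v *)
From HB Require Import structures.
From mathcomp Require Import all_boot all_algebra.
From mathcomp Require Import boolp.
Require Import Defs.

Set Implicit Arguments.
Unset Strict Implicit.
Unset Printing Implicit Defensive.

Import GRing.Theory.

(** A simply connected [G] with a chosen object [x] contains the weakly equivalent
    1-reduced groupoid [reduction x] of the cells whose 1-source and 1-target are
    the unit of [x].  A morphism [f : G -> H] induces [u |-> p (f u) p^-1] on
    these, where [p] is any path from [f x] to the chosen object of [H].  Two
    paths give the same map on the nose: a loop bounded by a 2-arrow commutes,
    by the exchange law, with every cell whose 1-boundary is trivial.  Hence
    reduction is a strict functor.  The inclusions [reduction x -> G] are natural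
    only up to conjugation, but conjugation by [p] extends to a homotopy on the
    product with the contractible groupoid on two objects, and so becomes
    trivial in the homotopy category.

    If [G] is 1-reduced, then the composition along objects is defined everywhere and,
    by Eckmann-Hilton, is an abelian group law in every dimension; the other
    compositions are determined by [v *_j u = v - 1_(s_j v) + u].  Then [G] is [K]
    of the complex of the cells whose source is zero, with the target as
    differential.  The homotopy groups of [UK C] are the homology groups of [C]. *)

(** * Categories and their localizations *)

Section Categories.
Implicit Types C D E : category.

Lemma heq_refl C (x y : C) (f : hom x y) : heq f f.
Proof. by case: (heq_equiv x y). Qed.

Lemma heq_sym C (x y : C) (f g : hom x y) : heq f g -> heq g f.
Proof. by case: (heq_equiv x y) => _ s _; apply: s. Qed.

Lemma heq_trans C (x y : C) (f g h : hom x y) : heq f g -> heq g h -> heq f h.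
Proof. by case: (heq_equiv x y) => _ _ t; apply: t. Qed.

Lemma cmp_heql C (x y z : C) (g g' : hom y z) (f : hom x y) :
  heq g g' -> heq (cmp g f) (cmp g' f).
Proof. by move=> gg'; apply: cmp_heq gg' (heq_refl _). Qed.

Lemma cmp_heqr C (x y z : C) (g : hom y z) (f f' : hom x y) :
  heq f f' -> heq (cmp g f) (cmp g f').
Proof. by move=> ff'; apply: cmp_heq (heq_refl _) ff'. Qed.

Lemma cmpKm C (x y z : C) (f : hom x y) (g : hom y x) (h : hom z x) :
  heq (cmp g f) (idm x) -> heq (cmp g (cmp f h)) h.
Proof.
move=> gf; apply: heq_trans (cmpA _ _ _) _.
exact: heq_trans (cmp_heql _ gf) (cmp1m _).
Qed.

(** Squares paste along composites, and the square of a formal inverse is the square of [w] composed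
    on both sides with the inverses of the images of [w]. Hence only morphisms of [C] have to be
    checked. *)
Lemma loc_natural C D (W : mclass C) (F G : functor (loc W) D)
    (eta : forall x : C, hom (F x) (G x)) :
  (forall (x y : C) (f : hom x y),
     heq (cmp (eta y) (fmor F (loc_in W f : @hom (loc W) x y)))
         (cmp (fmor G (loc_in W f : @hom (loc W) x y)) (eta x))) ->
  forall (x y : loc W) (f : hom x y),
    heq (cmp (eta y) (fmor F f)) (cmp (fmor G f) (eta x)).
Proof.
move=> nat x y; elim=> {x y} [//|x y w Ww|x y z g IHg f IHf].
- pose v : @hom (loc W) x y := loc_in W w.
  pose v' : @hom (loc W) y x := loc_inv w Ww.
  have FV (H : functor (loc W) D) : heq (cmp (fmor H v) (fmor H v')) (idm _).
    apply: heq_trans (heq_sym (fmorM H _ _)) _.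
    apply: heq_trans (fmor1 H y); apply: fmor_heq; exact: loc_invr.
  have VF (H : functor (loc W) D) : heq (cmp (fmor H v') (fmor H v)) (idm _).
    apply: heq_trans (heq_sym (fmorM H _ _)) _.
    apply: heq_trans (fmor1 H x); apply: fmor_heq; exact: loc_invl.
  apply: heq_trans (heq_sym (cmpKm _ (VF G))) _; apply: cmp_heqr.
  apply: heq_trans (cmpA _ _ _) _.
  apply: heq_trans (cmp_heql _ (heq_sym (nat _ _ w))) _.
  apply: heq_trans (heq_sym (cmpA _ _ _)) _.
  exact: heq_trans (cmp_heqr _ (FV F)) (cmpm1 _).
- apply: heq_trans (cmp_heqr _ (fmorM F (g : @hom (loc W) _ _) f)) _.
  apply: heq_trans (cmpA _ _ _) _; apply: heq_trans (cmp_heql _ IHg) _.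
  apply: heq_trans (heq_sym (cmpA _ _ _)) _.
  apply: heq_trans (cmp_heqr _ IHf) _; apply: heq_trans (cmpA _ _ _) _.
  by apply: cmp_heql; apply: heq_sym (fmorM _ _ _).
Qed.

Lemma loc_in_invertible C (W : mclass C) (x y : C) (f : hom x y) :
  invertible f -> invertible (loc_in W f : @hom (loc W) x y).
Proof.
move=> [g [gf fg]]; exists (loc_in W g).
split; apply: loc_trans (loc_sym (loc_in_cmp _ _ _)) _; exact: loc_in_eq.
Qed.

Lemma loc_in_invertible_W C (W : mclass C) (x y : C) (f : hom x y) :
  W x y f -> invertible (loc_in W f : @hom (loc W) x y).
Proof. by move=> Wf; exists (loc_inv f Wf); split; constructor. Qed.

(** Localizing leaves the objects unchanged, so the components of the isomorphism, pushed along
    [loc_in], serve again; by [loc_natural] formal inverses need no separate check. *)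
Lemma loc_isomorphic_id C D (W : mclass C) (V : mclass D) (F : functor C D)
    (G : functor D C) (FW : preserves W V F) (GV : preserves V W G) :
  isomorphic_functors (functor_comp G F) (functor_id C) ->
  isomorphic_functors (functor_comp (loc_functor GV) (loc_functor FW))
    (functor_id (loc W)).
Proof.
move=> [eta [nat inv]].
exists (fun x => loc_in W (eta x) : @hom (loc W) _ _); split; last first.
  by move=> x; apply: loc_in_invertible (inv x).
apply: loc_natural => x y f /=.
apply: loc_trans (loc_sym (loc_in_cmp _ _ _)) _.
apply: loc_trans (loc_in_cmp _ _ _); exact: loc_in_eq (nat _ _ f).
Qed.

Lemma loc_quasi_inverse C D (W : mclass C) (V : mclass D) (F : functor C D)
    (G : functor D C) (FW : preserves W V F) (GV : preserves V W G) :
  quasi_inverse F G -> quasi_inverse (loc_functor FW) (loc_functor GV).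
Proof. by move=> [GF FG]; split; apply: loc_isomorphic_id. Qed.

Lemma quasi_inverse_sym C D (F : functor C D) (G : functor D C) :
  quasi_inverse F G -> quasi_inverse G F.
Proof. by case. Qed.

(** * Quasi-inverse of a fully faithful and essentially surjective functor *)

Section FullyFaithful.
Variables (C D : category) (F : functor C D).
Variable lift : forall x y : C, hom (F x) (F y) -> hom x y.
Hypothesis fmor_lift : forall x y (g : hom (F x) (F y)), heq (fmor F (lift g)) g.
Hypothesis faithful : forall x y (f g : hom x y),
  heq (fmor F f) (fmor F g) -> heq f g.
Variables (E0 : D -> C) (phi : forall d, hom (F (E0 d)) d).
Variable psi : forall d, hom d (F (E0 d)).
Hypothesis psiK : forall d, heq (cmp (phi d) (psi d)) (idm d).
Hypothesis phiK : forall d, heq (cmp (psi d) (phi d)) (idm (F (E0 d))).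

Let E1 d d' (f : hom d d') := lift (cmp (psi d') (cmp f (phi d))).

Let FE1 d d' (f : hom d d') :
  heq (fmor F (E1 f)) (cmp (psi d') (cmp f (phi d))).
Proof. exact: fmor_lift. Qed.

Let phi_nat d d' (f : hom d d') :
  heq (cmp (phi d') (fmor F (E1 f))) (cmp f (phi d)).
Proof. exact: heq_trans (cmp_heqr _ (FE1 f)) (cmpKm _ (psiK _)). Qed.

(** Fullness and essential surjectivity are given as functions: [lift], and [E0] with [phi] and
    [psi]. A morphism is conjugated by [phi] and [psi] and then lifted; the functor laws are checked
    after applying [F], which suffices by faithfulness. *)
Definition inverse_functor : functor D C.
Proof using lift fmor_lift faithful phi psi psiK phiK.
exists E0 E1.
- move=> d d' f g fg; apply: faithful.
  apply: heq_trans (FE1 f) (heq_trans _ (heq_sym (FE1 g))).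
  by apply/cmp_heqr/cmp_heql.
- move=> d; apply: faithful; apply: heq_trans (FE1 _) _.
  apply: heq_trans (cmp_heqr _ (cmp1m _)) _.
  exact: heq_trans (phiK d) (heq_sym (fmor1 _ _)).
- move=> d d' d'' g f; apply: faithful; apply: heq_trans (FE1 _) _.
  apply: heq_trans (heq_sym (fmorM F _ _)).
  apply: heq_trans (heq_sym (cmp_heql _ (FE1 _))).
  apply: heq_trans (cmpA _ _ _); apply: cmp_heqr.
  apply: heq_trans (cmpA _ _ _).
  apply: heq_trans (heq_sym (cmp_heqr _ (phi_nat f))); exact/heq_sym/cmpA.
Defined.

Lemma inverse_functorP : quasi_inverse F inverse_functor.
Proof.
split; last first.
  exists phi; split=> [d d' f|d]; first exact: phi_nat.
  by exists (psi d); split; [apply: phiK | apply: psiK].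
(* On the side of [C] the component is the lift of [phi (F x)]; its naturality and invertibility are
   tested after applying [F]. *)
exists (fun x => lift (phi (F x))); split=> [x y f|x].
- apply: faithful; apply: heq_trans (fmorM F _ _) _.
  apply: heq_trans (heq_sym (fmorM F _ _)).
  apply: heq_trans (cmp_heql _ (fmor_lift _)) _.
  apply: heq_trans (heq_sym (cmp_heqr _ (fmor_lift _))); exact: phi_nat.
- exists (lift (psi (F x))); split; apply: faithful;
    apply: heq_trans (fmorM F _ _) _; apply: heq_trans (heq_sym (fmor1 F _));
    apply: heq_trans (cmp_heq (fmor_lift _) (fmor_lift _)) _.
  + exact: phiK.
  + exact: psiK.
Qed.

End FullyFaithful.
End Categories.

(** * Weak equivalences *)

Section WeakEquivalences.

(** The condition that defines [loops], unbundled and for any [ocat]. *)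
Definition is_loop (X : ocat) m (x : X 0) (u : X m.+1) :=
  src u = unts m x /\ tgt u = unts m x.

Lemma homotopic_refl (X : ocat) n (u : X n) : homotopic u u.
Proof. by exists (unt u); rewrite src_unt tgt_unt. Qed.

Lemma ofn_homotopic (X Y : ocat) (f : ofun X Y) n (u v : X n) :
  homotopic u v -> homotopic (ofn f u) (ofn f v).
Proof. by move=> [a [<- <-]]; exists (ofn f a); rewrite ofn_src ofn_tgt. Qed.

Lemma ofn_is_loop (X Y : ocat) (f : ofun X Y) m (x : X 0) (u : X m.+1) :
  is_loop x u -> is_loop (ofn f x) (ofn f u).
Proof. by move=> [su tu]; split; rewrite -?ofn_src -?ofn_tgt ?su ?tu ofn_unts. Qed.

(* Compatibility with the group laws is automatic, so that no equality of base
   points has to be transported along. *)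
Record weq (X Y : ocat) (f : ofun X Y) : Prop := Weq {
  weq_inj0 : forall x y : X 0, homotopic (ofn f x) (ofn f y) -> homotopic x y;
  weq_surj0 : forall y : Y 0, exists x : X 0, homotopic (ofn f x) y;
  weq_inj : forall m (x : X 0) (u v : X m.+1), is_loop x u -> is_loop x v ->
    homotopic (ofn f u) (ofn f v) -> homotopic u v;
  weq_surj : forall m (x : X 0) (w : Y m.+1), is_loop (ofn f x) w ->
    exists2 u : X m.+1, is_loop x u & homotopic (ofn f u) w }.

Lemma weqP (G H : oGpd) (f : hom G H) :
  weak_equivalence f <-> weq (f : ofun (gcell G) (gcell H)).
Proof.
split=> [[[_ inj0 surj0] piso]|[inj0 surj0 inj surj]].
- split=> // m x.
  + move=> u v lu lv; have [[_ inj _] _] := piso m x.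
    exact: (inj (exist _ u lu) (exist _ v lv)).
  + move=> w lw; have [[_ _ surj] _] := piso m x.
    have [[u lu] uw] := surj (exist _ w lw).
    by exists u.
- split.
    split=> //; first exact: (@ofn_homotopic _ _ f).
  move=> m x; split; first split.
  + by move=> [u lu] [v lv]; apply: (@ofn_homotopic _ _ f).
  + by move=> [u lu] [v lv]; apply: inj lu lv.
  + by move=> [w lw]; have [u lu uw] := surj m x w lw; exists (exist _ u lu).
  + move=> [u [su tu]] [v [sv tv]]; rewrite /seqv /= ofn_comp //.
      exact: homotopic_refl.
    by apply: composableS; rewrite su tv.
Qed.

Lemma homotopic_trans (G : oGpd) n (u v w : G n) :
  homotopic u v -> homotopic v w -> homotopic u w.
Proof. by case: (homotopic_equiv G n) => _ _ t; apply: t. Qed.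

Lemma homotopic_sym (G : oGpd) n (u v : G n) : homotopic u v -> homotopic v u.
Proof. by case: (homotopic_equiv G n) => _ s _; apply: s. Qed.

Lemma weq_eq (X Y : ocat) (f g : ofun X Y) :
  (forall n (u : X n), ofn f u = ofn g u) -> weq f -> weq g.
Proof.
move=> fg [inj0 surj0 inj surj]; split.
- by move=> x y; rewrite -!fg; apply: inj0.
- by move=> y; have [x xy] := surj0 y; exists x; rewrite -fg.
- by move=> m x u v lu lv; rewrite -!fg; apply: inj lu lv.
- move=> m x w; rewrite -fg => /surj [u lu uw].
  by exists u; rewrite -?fg.
Qed.

Lemma weq_comp (X Y : ocat) (Z : oGpd) (g : ofun Y (gcell Z)) (f : ofun X Y) :
  weq f -> weq g -> weq (ofun_comp g f).
Proof.
move=> [fi0 fs0 fi fs] [gi0 gs0 gi gs]; split=> /=.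
- by move=> x y /gi0/fi0.
- move=> z; have [y yz] := gs0 z; have [x xy] := fs0 y; exists x.
  exact: homotopic_trans (ofn_homotopic g xy) yz.
- move=> m x u v lu lv /gi uv; apply: fi (lu) (lv) (uv _ _ _).
  + exact: ofn_is_loop lu.
  + exact: ofn_is_loop lv.
- move=> m x w /gs [v lv vw]; have [u lu uv] := fs _ _ _ lv; exists u => //.
  exact: homotopic_trans (ofn_homotopic g uv) vw.
Qed.

(** Applying [g] reduces injectivity to that of the composite. For surjectivity, a preimage of the
    class of [g w] under the composite is found first; the homotopy then descends to [Y] because [g]
    is injective on classes. *)
Lemma weq_right_cancel (X Y : ocat) (Z : oGpd) (g : ofun Y (gcell Z)) (f : ofun X Y) :
  weq g -> weq (ofun_comp g f) -> weq f.
Proof.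
move=> [gi0 gs0 gi gs] [i0 s0 inj surj]; split=> /=.
- by move=> x y /(ofn_homotopic g)/i0.
- by move=> y; have [x /gi0 xy] := s0 (ofn g y); exists x.
- by move=> m x u v lu lv /(ofn_homotopic g); apply: inj lu lv.
- move=> m x w lw; have [u lu uw] := surj _ _ _ (ofn_is_loop g lw).
  by exists u => //; apply: gi uw; [apply: ofn_is_loop lu | apply: lw].
Qed.

Section InverseOfun.
Variables (X Y : ocat) (f : ofun X Y) (g : forall n, Y n -> X n).
Hypotheses (fK : forall n (u : X n), g (ofn f u) = u).
Hypothesis gK : forall n (u : Y n), ofn f (g u) = u.

Definition inverse_ofun : ofun Y X.
Proof using f g fK gK.
exists g.
- by move=> i u; rewrite -{1}(gK u) -ofn_src fK.
- by move=> i u; rewrite -{1}(gK u) -ofn_tgt fK.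
- by move=> i u; rewrite -{1}(gK u) -ofn_unt fK.
- move=> i j v u ji vu; rewrite -{1}(gK u) -{1}(gK v) -ofn_comp ?fK //.
  rewrite /composable -/(srcs _ _) -/(tgts _ _) -[LHS]fK -[RHS]fK.
  by rewrite ofn_srcs ofn_tgts !gK vu.
Defined.
End InverseOfun.

Lemma weq_bij (X Y : ocat) (f : ofun X Y) (g : ofun Y X) :
  (forall n (u : X n), ofn g (ofn f u) = u) ->
  (forall n (u : Y n), ofn f (ofn g u) = u) -> weq f.
Proof.
move=> fK gK; split.
- by move=> x y /(ofn_homotopic g); rewrite !fK.
- by move=> y; exists (ofn g y); rewrite gK; apply: homotopic_refl.
- by move=> m x u v _ _ /(ofn_homotopic g); rewrite !fK.
- move=> m x w /(ofn_is_loop g); rewrite fK => lw.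
  by exists (ofn g w) => //; rewrite gK; apply: homotopic_refl.
Qed.

Lemma weak_equivalence_invertible (G H : oGpd) (f : hom G H) :
  invertible f -> weak_equivalence f.
Proof. by move=> [g [gf fg]]; apply/weqP; apply: (@weq_bij _ _ f g). Qed.

End WeakEquivalences.

(** * Iterated sources, targets and units *)

Section Globular.
Variable X : ocat.

Lemma srcs_src i j (u : X i.+1) : j <= i -> srcs j (src u) = srcs j u.
Proof. by move=> ji; rewrite /srcs move_dn. Qed.

Lemma tgts_tgt i j (u : X i.+1) : j <= i -> tgts j (tgt u) = tgts j u.
Proof. by move=> ji; rewrite /tgts move_dn. Qed.

Lemma srcs_tgt i j (u : X i.+1) : j < i -> srcs j (tgt u) = srcs j u.
Proof.
by case: i u => // i u ji; rewrite -[RHS]srcs_src 1?ltnW // -!srcs_src // src_src.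
Qed.

Lemma tgts_src i j (u : X i.+1) : j < i -> tgts j (src u) = tgts j u.
Proof.
by case: i u => // i u ji; rewrite -[RHS]tgts_tgt 1?ltnW // -!tgts_tgt // tgt_src.
Qed.

Lemma srcs_id i (u : X i) : srcs i u = u.
Proof. exact: move_id. Qed.

Lemma tgts_id i (u : X i) : tgts i u = u.
Proof. exact: move_id. Qed.

Lemma unts_id i (u : X i) : unts i u = u.
Proof. exact: move_id. Qed.

Lemma unts_unt i j (u : X j) : j <= i -> unts i.+1 u = unt (unts i u).
Proof. by move=> ji; rewrite /unts move_up. Qed.

Lemma src_unts i j (u : X j) : j <= i -> src (unts i.+1 u) = unts i u.
Proof. by move=> ji; rewrite unts_unt // src_unt. Qed.

Lemma tgt_unts i j (u : X j) : j <= i -> tgt (unts i.+1 u) = unts i u.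
Proof. by move=> ji; rewrite unts_unt // tgt_unt. Qed.

Lemma unts_unts i j k (u : X k) : k <= j -> j <= i ->
  unts i (unts j u) = unts i u.
Proof.
move=> kj; elim: i => [|i IH] ji.
  by move: ji u; rewrite leqn0 => /eqP ->.
move: ji; rewrite leq_eqVlt => /predU1P[ji|]; first by subst j; rewrite unts_id.
by rewrite ltnS => ji; rewrite unts_unt // IH // unts_unt // (leq_trans kj).
Qed.

Lemma srcs_unts i j k (u : X k) : k <= j -> j <= i ->
  srcs j (unts i u) = unts j u.
Proof.
move=> kj; elim: i => [|i IH] ji.
  move: ji u kj; rewrite leqn0 => /eqP -> u; rewrite leqn0 => /eqP k0.
  by subst k; rewrite srcs_id.
move: ji; rewrite leq_eqVlt => /predU1P[ji|]; first by subst j; rewrite srcs_id.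
by rewrite ltnS => ji; rewrite -srcs_src // src_unts ?IH // (leq_trans kj).
Qed.

Lemma tgts_unts i j k (u : X k) : k <= j -> j <= i ->
  tgts j (unts i u) = unts j u.
Proof.
move=> kj; elim: i => [|i IH] ji.
  move: ji u kj; rewrite leqn0 => /eqP -> u; rewrite leqn0 => /eqP k0.
  by subst k; rewrite tgts_id.
move: ji; rewrite leq_eqVlt => /predU1P[ji|]; first by subst j; rewrite tgts_id.
by rewrite ltnS => ji; rewrite -tgts_tgt // tgt_unts ?IH // (leq_trans kj).
Qed.

Lemma srcs_unts_low i j k (u : X k) : j <= k -> k <= i ->
  srcs j (unts i u) = srcs j u.
Proof.
move=> jk; elim: i => [|i IH] ki.
  by move: ki u jk; rewrite leqn0 => /eqP -> u jk; rewrite unts_id.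
move: ki; rewrite leq_eqVlt => /predU1P[ki|]; first by subst k; rewrite unts_id.
by rewrite ltnS => ki; rewrite -srcs_src ?src_unts ?IH // (leq_trans jk).
Qed.

Lemma tgts_unts_low i j k (u : X k) : j <= k -> k <= i ->
  tgts j (unts i u) = tgts j u.
Proof.
move=> jk; elim: i => [|i IH] ki.
  by move: ki u jk; rewrite leqn0 => /eqP -> u jk; rewrite unts_id.
move: ki; rewrite leq_eqVlt => /predU1P[ki|]; first by subst k; rewrite unts_id.
by rewrite ltnS => ki; rewrite -tgts_tgt ?tgt_unts ?IH // (leq_trans jk).
Qed.

Lemma composableP i j (v u : X i) :
  composable j v u <-> srcs j v = tgts j u.
Proof. by []. Qed.

Lemma composable_src i j (v u : X i.+1) : j < i ->
  composable j v u -> composable j (src v) (src u).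
Proof.
by move=> ji /composableP vu; apply/composableP; rewrite srcs_src 1?ltnW // tgts_src.
Qed.

Lemma composable_tgt i j (v u : X i.+1) : j < i ->
  composable j v u -> composable j (tgt v) (tgt u).
Proof.
by move=> ji /composableP vu; apply/composableP; rewrite tgts_tgt 1?ltnW // srcs_tgt.
Qed.

Lemma srcs_comp_low i j k (v u : X i) : k <= j -> j < i -> composable j v u ->
  srcs k (comp j v u) = srcs k u.
Proof.
move=> kj; elim: i v u => [//|i IH] v u; rewrite ltnS leq_eqVlt => /predU1P[ji|ji] vu.
  by subst j; rewrite -!(@srcs_src i k) // src_comp_top.
rewrite -!(@srcs_src i k) ?(leq_trans kj) 1?ltnW // src_comp // IH //.
exact: composable_src.
Qed.

Lemma tgts_comp_low i j k (v u : X i) : k <= j -> j < i -> composable j v u ->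
  tgts k (comp j v u) = tgts k v.
Proof.
move=> kj; elim: i v u => [//|i IH] v u; rewrite ltnS leq_eqVlt => /predU1P[ji|ji] vu.
  by subst j; rewrite -!(@tgts_tgt i k) // tgt_comp_top.
rewrite -!(@tgts_tgt i k) ?(leq_trans kj) 1?ltnW // tgt_comp // IH //.
exact: composable_tgt.
Qed.

Lemma srcs_comp i j k (v u : X i) : k < j -> j <= i -> composable k v u ->
  srcs j (comp k v u) = comp k (srcs j v) (srcs j u).
Proof.
move=> kj; elim: i v u => [|i IH] v u; first by case: j kj.
rewrite leq_eqVlt => /predU1P[ji|]; first by subst j; rewrite !srcs_id.
rewrite ltnS => ji vu; have ki := leq_trans kj ji.
by rewrite -!(@srcs_src i) // src_comp // IH //; apply: composable_src.
Qed.

Lemma tgts_comp i j k (v u : X i) : k < j -> j <= i -> composable k v u ->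
  tgts j (comp k v u) = comp k (tgts j v) (tgts j u).
Proof.
move=> kj; elim: i v u => [|i IH] v u; first by case: j kj.
rewrite leq_eqVlt => /predU1P[ji|]; first by subst j; rewrite !tgts_id.
rewrite ltnS => ji vu; have ki := leq_trans kj ji.
by rewrite -!(@tgts_tgt i) // tgt_comp // IH //; apply: composable_tgt.
Qed.

Lemma srcs_srcs i j k (u : X i) : k <= j -> j <= i -> srcs k (srcs j u) = srcs k u.
Proof.
move=> kj; elim: i u => [|i IH] u.
  by rewrite leqn0 => /eqP j0; subst j; rewrite srcs_id.
rewrite leq_eqVlt => /predU1P[ji|]; first by subst j; rewrite srcs_id.
by rewrite ltnS => ji; rewrite -(@srcs_src i j) // IH // srcs_src // (leq_trans kj).
Qed.

Lemma tgts_tgts i j k (u : X i) : k <= j -> j <= i -> tgts k (tgts j u) = tgts k u.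
Proof.
move=> kj; elim: i u => [|i IH] u.
  by rewrite leqn0 => /eqP j0; subst j; rewrite tgts_id.
rewrite leq_eqVlt => /predU1P[ji|]; first by subst j; rewrite tgts_id.
by rewrite ltnS => ji; rewrite -(@tgts_tgt i j) // IH // tgts_tgt // (leq_trans kj).
Qed.

Lemma srcs_tgts i j k (u : X i) : k < j -> j <= i -> srcs k (tgts j u) = srcs k u.
Proof.
move=> kj; elim: i u => [|i IH] u.
  by rewrite leqn0 => /eqP j0; subst j.
rewrite leq_eqVlt => /predU1P[ji|]; first by subst j; rewrite tgts_id.
by rewrite ltnS => ji; rewrite -(@tgts_tgt i j) // IH // srcs_tgt // (leq_trans kj).
Qed.

Lemma comp_unit i j (u e : X i) : j < i -> e = unts i (srcs j u) ->
  comp j u e = u.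
Proof. by move=> ji ->; apply: comp_unts. Qed.

Lemma unit_comp i j (u e : X i) : j < i -> e = unts i (tgts j u) ->
  comp j e u = u.
Proof. by move=> ji ->; apply: unts_comp. Qed.

Lemma tgts_srcs i j k (u : X i) : k < j -> j <= i -> tgts k (srcs j u) = tgts k u.
Proof.
move=> kj; elim: i u => [|i IH] u.
  by rewrite leqn0 => /eqP j0; subst j.
rewrite leq_eqVlt => /predU1P[ji|]; first by subst j; rewrite srcs_id.
by rewrite ltnS => ji; rewrite -(@srcs_src i j) // IH // tgts_src // (leq_trans kj).
Qed.

(* The Peiffer-type relation: in [B *_0 u = B *_1 (L *_0 u) = u *_1 B] and
   [u *_0 B = B *_1 (u *_0 L) = u *_1 B], where [L] is the 1-source of [B], each
   equality is an exchange law with units. *)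
Section Whisker.
Variables (i : nat) (y : X 0) (u B : X i.+2).
Hypotheses (su : srcs 1 u = unt y) (tu : tgts 1 u = unt y).
Hypotheses (sB : srcs 0 B = y) (tB : tgts 1 B = unt y).

Let L : X i.+2 := unts i.+2 (srcs 1 B).
Let e : X i.+2 := unts i.+2 y.

Let eE : e = unts i.+2 (unt y). Proof. by rewrite -untsS unts_unts. Qed.
Let s0u : srcs 0 u = y.
Proof. by rewrite -(@srcs_srcs _ 1) // su srcsS src_unt. Qed.
Let t0u : tgts 0 u = y.
Proof. by rewrite -(@tgts_tgts _ 1) // tu tgtsS tgt_unt. Qed.
Let t0B : tgts 0 B = y.
Proof. by rewrite -(@tgts_tgts _ 1) // tB tgtsS tgt_unt. Qed.
Let s0e : srcs 0 e = y. Proof. by rewrite srcs_unts // unts_id. Qed.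
Let t0e : tgts 0 e = y. Proof. by rewrite tgts_unts // unts_id. Qed.
Let s1e : srcs 1 e = unt y. Proof. by rewrite srcs_unts // untsS. Qed.
Let t1e : tgts 1 e = unt y. Proof. by rewrite tgts_unts // untsS. Qed.
Let t1L : tgts 1 L = srcs 1 B. Proof. by rewrite tgts_unts // unts_id. Qed.
Let s0L : srcs 0 L = y. Proof. by rewrite srcs_unts_low // srcs_srcs. Qed.
Let t0L : tgts 0 L = y. Proof. by rewrite tgts_unts_low // tgts_srcs. Qed.
Let ue : comp 0 u e = u. Proof. by apply: comp_unit; rewrite // s0u. Qed.
Let eu : comp 0 e u = u. Proof. by apply: unit_comp; rewrite // t0u. Qed.
Let Be : comp 0 B e = B. Proof. by apply: comp_unit; rewrite // sB. Qed.
Let eB : comp 0 e B = B. Proof. by apply: unit_comp; rewrite // t0B. Qed.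
Let ue1 : comp 1 u e = u. Proof. by apply: comp_unit; rewrite // su. Qed.
Let eu1 : comp 1 e u = u. Proof. by apply: unit_comp; rewrite // tu. Qed.
Let eB1 : comp 1 e B = B. Proof. by apply: unit_comp; rewrite // tB. Qed.
Let BL1 : comp 1 B L = B. Proof. exact: comp_unit. Qed.

Let cBu : comp 0 B u = comp 1 u B.
Proof.
rewrite -[in LHS]eB1 -{1}ue1 exchange ?eu ?Be //.
- by apply/composableP; rewrite s1e tB.
- by apply/composableP; rewrite sB t0u.
- by apply/composableP; rewrite su t1e.
Qed.

Let cuB : comp 0 u B = comp 1 u B.
Proof.
rewrite -[in LHS]eB1 -{1}ue1 exchange ?ue ?eB //.
- by apply/composableP; rewrite su t1e.
- by apply/composableP; rewrite s0e t0e.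
- by apply/composableP; rewrite s1e tB.
Qed.

Lemma whisker_comm : comp 0 B u = comp 0 u B.
Proof using su tu sB tB. by rewrite cBu cuB. Qed.

Let cBL : comp 0 B u = comp 1 B (comp 0 L u).
Proof.
rewrite -{1}BL1 -{1}eu1 exchange ?Be //.
- by apply/composableP; rewrite s0L t0e.
- by apply/composableP; rewrite s1e tu.
Qed.

Let cLB : comp 0 u B = comp 1 B (comp 0 u L).
Proof.
rewrite -{1}BL1 -{1}eu1 exchange ?eB //.
- by apply/composableP; rewrite s1e tu.
- by apply/composableP; rewrite s0u t0B.
Qed.

(** By [cBL], [cLB] and [whisker_comm] the two sides agree after composing with [B] along dimension
    1, and [B] can be cancelled since it has an inverse for that composition. *)
Lemma source_comm : is_groupoid X -> comp 0 L u = comp 0 u L.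
Proof using su tu sB tB.
move=> /(_ _ 1 B isT) [B' [sB' tB' BB' B'B]].
have Lu : comp 1 B (comp 0 L u) = comp 1 B (comp 0 u L).
  by rewrite -cBL -cLB whisker_comm.
have s1L : srcs 1 L = srcs 1 B by rewrite srcs_unts // unts_id.
have cLu : composable 0 L u by apply/composableP; rewrite s0L t0u.
have cuL : composable 0 u L by apply/composableP; rewrite t0L.
have t1Lu : tgts 1 (comp 0 L u) = srcs 1 B.
  rewrite tgts_comp // t1L tu; apply: comp_unit => //.
  by rewrite srcs_srcs // sB untsS.
have t1uL : tgts 1 (comp 0 u L) = srcs 1 B.
  rewrite tgts_comp // t1L tu; apply: unit_comp => //.
  by rewrite tgts_srcs // t0B untsS.
have cancel w : tgts 1 w = srcs 1 B -> comp 1 B' (comp 1 B w) = w.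
  move=> tw; rewrite -compA // ?B'B.
  by apply: unit_comp; rewrite // tw.
by rewrite -(cancel _ t1Lu) Lu cancel.
Qed.

End Whisker.
End Globular.

(** * Sub-, product and chaotic infinity-categories *)

Section SubCategory.
Variables (X : ocat) (P : forall n, X n -> Prop).
Hypothesis P_src : forall n (u : X n.+1), P u -> P (src u).
Hypothesis P_tgt : forall n (u : X n.+1), P u -> P (tgt u).
Hypothesis P_unt : forall n (u : X n), P u -> P (unt u).
Hypothesis P_comp : forall n j (v u : X n), j < n -> composable j v u ->
  P v -> P u -> P (comp j v u).

Definition sub_cell n := {u : X n | P u}.

Lemma sub_cell_inj n (u v : sub_cell n) : sval u = sval v -> u = v.
Proof.
by case: u v => [u pu] [v pv] /= uv; subst v; rewrite (Prop_irrelevance pu pv).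
Qed.

Definition sub_src n (u : sub_cell n.+1) : sub_cell n :=
  exist _ (src (sval u)) (P_src (proj2_sig u)).
Definition sub_tgt n (u : sub_cell n.+1) : sub_cell n :=
  exist _ (tgt (sval u)) (P_tgt (proj2_sig u)).
Definition sub_unt n (u : sub_cell n) : sub_cell n.+1 :=
  exist _ (unt (sval u)) (P_unt (proj2_sig u)).
(** Outside composable pairs the value of [comp] is arbitrary and may leave [P], so the definition
    decides composability and falls back on the default [u]. *)
Definition sub_comp n j (v u : sub_cell n) : sub_cell n :=
  match pselect (j < n /\ composable j (sval v) (sval u)) with
  | left jvu => exist _ _ (P_comp (proj1 jvu) (proj2 jvu) (proj2_sig v) (proj2_sig u))
  | right _ => u
  end.

Lemma sub_compE n j (v u : sub_cell n) : j < n -> composable j (sval v) (sval u) ->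
  sval (sub_comp j v u) = comp j (sval v) (sval u).
Proof. by move=> jn vu; rewrite /sub_comp; case: pselect => // -[]. Qed.

Lemma sval_srcs i j (u : sub_cell i) :
  sval (move sub_src sub_unt i j u) = srcs j (sval u).
Proof. exact: (ofn_move (f := fun n (u : sub_cell n) => sval u)). Qed.

Lemma sval_tgts i j (u : sub_cell i) :
  sval (move sub_tgt sub_unt i j u) = tgts j (sval u).
Proof. exact: (ofn_move (f := fun n (u : sub_cell n) => sval u)). Qed.

Lemma sub_composable i j (v u : sub_cell i) :
  move sub_src sub_unt i j v = move sub_tgt sub_unt i j u <->
  composable j (sval v) (sval u).
Proof.
rewrite /composable -/(srcs _ _) -/(tgts _ _) -sval_srcs -sval_tgts.
by split=> [->|/sub_cell_inj].
Qed.

Definition sub_ocat : ocat.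
Proof.
apply: (@OCat sub_cell sub_src sub_tgt sub_unt sub_comp).
- by move=> i u; apply: sub_cell_inj; apply: src_src.
- by move=> i u; apply: sub_cell_inj; apply: tgt_src.
- move=> j v u /sub_composable vu; apply: sub_cell_inj.
  by rewrite /= sub_compE // src_comp_top.
- move=> i j v u ji /sub_composable vu; apply: sub_cell_inj.
  rewrite /= sub_compE ?src_comp ?sub_compE //; last exact: ltnW.
  exact: composable_src.
- move=> j v u /sub_composable vu; apply: sub_cell_inj.
  by rewrite /= sub_compE // tgt_comp_top.
- move=> i j v u ji /sub_composable vu; apply: sub_cell_inj.
  rewrite /= sub_compE ?tgt_comp ?sub_compE //; last exact: ltnW.
  exact: composable_tgt.
- by move=> i u; apply: sub_cell_inj; apply: src_unt.
- by move=> i u; apply: sub_cell_inj; apply: tgt_unt.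
- move=> i j w v u ji /sub_composable wv /sub_composable vu; apply: sub_cell_inj.
  rewrite /= !sub_compE ?compA //.
    by apply/composableP; rewrite tgts_comp_low.
  by apply/composableP; rewrite srcs_comp_low.
- move=> i j k d c b a kj ji /sub_composable dc /sub_composable cb /sub_composable ba.
  have ki := ltn_trans kj ji; apply: sub_cell_inj.
  have dc' : srcs j (sval d) = tgts j (sval c) := dc.
  have cb' : srcs k (sval c) = tgts k (sval b) := cb.
  have ba' : srcs j (sval b) = tgts j (sval a) := ba.
  (* Cells composable along dimension [j] share their [k]-sources and [k]-targets for [k < j], so
     the transposed pairs of the exchange law are composable too. *)
  have db : composable k (sval d) (sval b).
    apply/composableP; rewrite -cb' -(@srcs_srcs X i j k) 1?ltnW //.
    by rewrite dc' srcs_tgts // ltnW.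
  have ca : composable k (sval c) (sval a).
    apply/composableP; rewrite cb' -[RHS](@tgts_tgts X i j k) 1?ltnW // -ba'.
    by rewrite tgts_srcs // ltnW.
  have dcE := sub_compE ji dc; have baE := sub_compE ji ba.
  have dbE := sub_compE ki db; have caE := sub_compE ki ca.
  rewrite /= sub_compE //; last first.
    apply/composableP; rewrite dcE baE.
    by rewrite (srcs_comp_low (ltnW kj) ji dc) (tgts_comp_low (ltnW kj) ji ba).
  rewrite dcE baE exchange // [RHS]sub_compE //; last first.
    apply/composableP; rewrite dbE caE.
    by rewrite (srcs_comp kj (ltnW ji) db) (tgts_comp kj (ltnW ji) ca) dc' ba'.
  by rewrite dbE caE.
- move=> i j u ji; apply: sub_cell_inj.
  have E : sval (move sub_src sub_unt j i (move sub_src sub_unt i j u)) =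
           unts i (srcs j (sval u)) by rewrite sval_srcs sval_srcs.
  rewrite /= sub_compE // ?E ?comp_unts //.
  by apply/composableP; rewrite tgts_unts ?unts_id // ltnW.
- move=> i j u ji; apply: sub_cell_inj.
  have E : sval (move sub_src sub_unt j i (move sub_tgt sub_unt i j u)) =
           unts i (tgts j (sval u)) by rewrite sval_srcs sval_tgts.
  rewrite /= sub_compE // ?E ?unts_comp //.
  by apply/composableP; rewrite srcs_unts ?unts_id // ltnW.
- move=> i j v u ji /sub_composable vu; apply: sub_cell_inj.
  rewrite /= !sub_compE ?unt_comp //; first exact: ltnW.
  by apply/composableP; rewrite -srcs_src 1?ltnW // -tgts_tgt 1?ltnW //= src_unt tgt_unt.
Defined.

Definition sub_incl : ofun sub_ocat X.
Proof.
exists (fun n (u : sub_cell n) => sval u) => // i j v u ji /sub_composable vu.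
by rewrite /comp /= sub_compE.
Defined.

Definition corestrict (Y : ocat) (f : ofun Y X) (fP : forall n (u : Y n), P (ofn f u)) :
  ofun Y sub_ocat.
Proof.
exists (fun n u => exist _ (ofn f u) (fP n u)).
- by move=> n u; apply: sub_cell_inj; rewrite /= ofn_src.
- by move=> n u; apply: sub_cell_inj; rewrite /= ofn_tgt.
- by move=> n u; apply: sub_cell_inj; rewrite /= ofn_unt.
- move=> n j v u jn vu; apply: sub_cell_inj.
  rewrite /comp /= sub_compE ?ofn_comp //; exact: ofn_composable.
Defined.

Lemma sub_groupoid :
  (forall n j (u v : X n), j < n -> P u -> srcs j v = tgts j u ->
     tgts j v = srcs j u -> comp j u v = unts n (tgts j u) ->
     comp j v u = unts n (srcs j u) -> P v) ->
  is_groupoid X -> is_groupoid sub_ocat.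
Proof.
move=> P_inv gX i j u ji; have [v [sv tv uv vu]] := gX _ _ (sval u) ji.
have Pv := P_inv _ _ _ _ ji (proj2_sig u) sv tv uv vu.
exists (exist _ v Pv); split; apply: sub_cell_inj.
- by rewrite sval_srcs sval_tgts.
- by rewrite sval_srcs sval_tgts.
- by rewrite [LHS]sub_compE // [RHS]sval_srcs sval_tgts.
- by rewrite [LHS]sub_compE // [RHS]sval_srcs sval_srcs.
Qed.

End SubCategory.

Section Product.
Variables X Y : ocat.

Definition prod_cell n := (X n * Y n)%type.
Definition prod_src n (u : prod_cell n.+1) : prod_cell n := (src u.1, src u.2).
Definition prod_tgt n (u : prod_cell n.+1) : prod_cell n := (tgt u.1, tgt u.2).
Definition prod_unt n (u : prod_cell n) : prod_cell n.+1 := (unt u.1, unt u.2).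
Definition prod_comp n j (v u : prod_cell n) : prod_cell n :=
  (comp j v.1 u.1, comp j v.2 u.2).

Lemma prod_srcs i j (u : prod_cell i) :
  move prod_src prod_unt i j u = (srcs j u.1, srcs j u.2).
Proof.
by apply: injective_projections;
  [ apply: (ofn_move (f := fun n (u : prod_cell n) => u.1))
  | apply: (ofn_move (f := fun n (u : prod_cell n) => u.2))].
Qed.

Lemma prod_tgts i j (u : prod_cell i) :
  move prod_tgt prod_unt i j u = (tgts j u.1, tgts j u.2).
Proof.
by apply: injective_projections;
  [ apply: (ofn_move (f := fun n (u : prod_cell n) => u.1))
  | apply: (ofn_move (f := fun n (u : prod_cell n) => u.2))].
Qed.

Lemma prod_composable i j (v u : prod_cell i) :
  move prod_src prod_unt i j v = move prod_tgt prod_unt i j u ->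
  composable j v.1 u.1 /\ composable j v.2 u.2.
Proof. by rewrite prod_srcs prod_tgts => -[]. Qed.

Definition prod_ocat : ocat.
Proof.
apply: (@OCat prod_cell prod_src prod_tgt prod_unt prod_comp).
- by move=> i u; rewrite /prod_src /= !src_src.
- by move=> i u; rewrite /prod_tgt /= !tgt_src.
- by move=> j v u /prod_composable[c1 c2]; rewrite /prod_src /= !src_comp_top.
- by move=> i j v u ji /prod_composable[c1 c2]; rewrite /prod_src /= !src_comp.
- by move=> j v u /prod_composable[c1 c2]; rewrite /prod_tgt /= !tgt_comp_top.
- by move=> i j v u ji /prod_composable[c1 c2]; rewrite /prod_tgt /= !tgt_comp.
- by move=> i [u1 u2]; rewrite /prod_src /= !src_unt.
- by move=> i [u1 u2]; rewrite /prod_tgt /= !tgt_unt.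
- move=> i j w v u ji /prod_composable[c1 c2] /prod_composable[d1 d2].
  by rewrite /prod_comp /= !compA.
- move=> i j k d c b a kj ji /prod_composable[c1 c2] /prod_composable[d1 d2].
  by move=> /prod_composable[b1 b2]; rewrite /prod_comp /=; congr pair; apply: exchange.
- by move=> i j [u1 u2] ji; rewrite !prod_srcs /prod_comp /= !comp_unts.
- by move=> i j [u1 u2] ji; rewrite prod_srcs prod_tgts /prod_comp /= !unts_comp.
- by move=> i j v u ji /prod_composable[c1 c2]; rewrite /prod_unt /= !unt_comp.
Defined.

Lemma prod_groupoid : is_groupoid X -> is_groupoid Y -> is_groupoid prod_ocat.
Proof.
move=> gX gY i j [u1 u2] ji.
have [v1 [s1 t1 uv1 vu1]] := gX _ _ u1 ji.
have [v2 [s2 t2 uv2 vu2]] := gY _ _ u2 ji.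
exists (v1, v2); split; rewrite /srcs /tgts /unts /comp /=.
- by rewrite prod_srcs prod_tgts s1 s2.
- by rewrite prod_srcs prod_tgts t1 t2.
- by rewrite prod_tgts prod_srcs /prod_comp /= uv1 uv2.
- by rewrite !prod_srcs /prod_comp /= vu1 vu2.
Qed.

Definition prod_fst : ofun prod_ocat X.
Proof. by exists (fun n (u : prod_cell n) => u.1). Defined.

Definition prod_snd : ofun prod_ocat Y.
Proof. by exists (fun n (u : prod_cell n) => u.2). Defined.

Definition prod_pair (Z : ocat) (f : ofun Z X) (g : ofun Z Y) : ofun Z prod_ocat.
Proof.
exists (fun n (u : Z n) => (ofn f u, ofn g u) : prod_cell n).
- by move=> n u; rewrite /src /= /prod_src !ofn_src.
- by move=> n u; rewrite /tgt /= /prod_tgt !ofn_tgt.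
- by move=> n u; rewrite !ofn_unt.
- by move=> n j v u jn vu; rewrite !ofn_comp.
Defined.

End Product.

(* The groupoid with objects [S] and exactly one n-arrow between two objects,
   for every [n > 0]; an arrow is the pair of its 0-source and 0-target. *)
Section Chaotic.
Variable S : Type.

Definition chaotic_cell n : Type := match n with 0 => S | _ => (S * S)%type end.

Definition chaotic_src n : chaotic_cell n.+1 -> chaotic_cell n :=
  match n with 0 => fst | _ => id end.
Definition chaotic_tgt n : chaotic_cell n.+1 -> chaotic_cell n :=
  match n with 0 => snd | _ => id end.
Definition chaotic_unt n : chaotic_cell n -> chaotic_cell n.+1 :=
  match n with 0 => fun a => (a, a) | _ => id end.
(** For [j > 0] composable cells coincide, so the second one is already the composite. *)
Definition chaotic_comp n (j : nat) : chaotic_cell n -> chaotic_cell n -> chaotic_cell n :=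
  match n, j with
  | n'.+1, 0 => fun v u => (u.1, v.2)
  | _, _ => fun v u => u
  end.

Lemma move_const (T : Type) i j (x : T) :
  @move (fun=> T) (fun=> id) (fun=> id) i j x = x.
Proof. by elim: i j => [|i IH] [|j] /=; rewrite ?IH //; elim: j. Qed.

Lemma chaotic_srcsS i j (u : chaotic_cell i.+1) :
  move chaotic_src chaotic_unt i.+1 j.+1 u = u.
Proof. exact: move_const. Qed.

Lemma chaotic_tgtsS i j (u : chaotic_cell i.+1) :
  move chaotic_tgt chaotic_unt i.+1 j.+1 u = u.
Proof. exact: move_const. Qed.

Lemma chaotic_srcs0 i (u : chaotic_cell i.+1) :
  move chaotic_src chaotic_unt i.+1 0 u = u.1.
Proof. by elim: i u => [|i IH] u //; rewrite move_dn // IH. Qed.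

Lemma chaotic_tgts0 i (u : chaotic_cell i.+1) :
  move chaotic_tgt chaotic_unt i.+1 0 u = u.2.
Proof. by elim: i u => [|i IH] u //; rewrite move_dn // IH. Qed.

Lemma chaotic_unts i (a : S) :
  move chaotic_src chaotic_unt 0 i.+1 (a : chaotic_cell 0) = (a, a).
Proof. by elim: i => [|i IH] //; rewrite move_up // IH. Qed.

Definition chaotic : ocat.
Proof.
apply: (@OCat chaotic_cell chaotic_src chaotic_tgt chaotic_unt chaotic_comp).
- by case.
- by case.
- by case.
- by case=> // i [|j].
- by case=> // j v u; rewrite chaotic_srcsS chaotic_tgtsS.
- by case=> // i [|j].
- by case.
- by case.
- by case=> // i [|j].
- by case=> // i [|j] // [|k].
- move=> [|i] [|j] // [a b] _; first by rewrite chaotic_srcs0 chaotic_unts.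
  by rewrite [LHS]chaotic_srcsS [LHS]chaotic_srcsS.
- by move=> [|i] [|j] // [a b] _; rewrite chaotic_tgts0 chaotic_unts.
- by case=> // i [|j].
Defined.

Lemma chaotic_groupoid : is_groupoid chaotic.
Proof.
case=> // i [|j] u _; rewrite /srcs /tgts /unts /comp.
- exists (u.2, u.1); rewrite !chaotic_srcs0 !chaotic_tgts0 !chaotic_unts.
  by [].
- by exists u; rewrite !chaotic_srcsS !chaotic_tgtsS.
Qed.

Definition chaotic_point (X : ocat) (s : S) : ofun X chaotic.
Proof.
exists (fun n _ => match n return chaotic_cell n with 0 => s | _ => (s, s) end).
- by case.
- by case.
- by case.
- by case=> // n [|j].
Defined.

Lemma chaotic_loop m (x : chaotic 0) (u v : chaotic m.+1) : is_loop x u -> is_loop x v -> u = v.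
Proof.
case: m u v => [|m] [a b] [c d] [/= su tu] [/= sv tv].
  by move: su tu sv tv; rewrite /src /tgt /= => -> -> -> ->.
by rewrite [LHS](_ : _ = src ((a, b) : chaotic m.+2)) // su -sv.
Qed.

End Chaotic.

(** The chaotic factor is contractible: an object, homotopy or loop of [X] lifts once it is paired
    with a suitable chaotic cell, and one with the required boundary always exists. *)
Lemma prod_chaotic_weq (X : ocat) (S : Type) (s0 : S) : weq (prod_fst X (chaotic S)).
Proof.
have loop2 m (x : prod_ocat X (chaotic S) 0) (u : prod_ocat X (chaotic S) m.+1) :
    is_loop x u -> is_loop x.2 u.2 by exact: (ofn_is_loop (prod_snd X (chaotic S))).
split.
- move=> [x s] [y t] [a [/= ax ay]].
  by exists (a, (s, t)); rewrite /src /tgt /= /prod_src /prod_tgt /= ax ay.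
- by move=> y; exists (y, s0); apply: homotopic_refl.
- move=> m x u v lu lv [a [/= au av]].
  have uv2 := chaotic_loop (loop2 _ _ _ lu) (loop2 _ _ _ lv).
  (* Chaotic cells of all positive dimensions have the same type and [u.2] is its own unit, so it
     bounds the equal loops [u.2] and [v.2]. *)
  exists (a, u.2 : chaotic S m.+2); rewrite /src /tgt /= /prod_src /prod_tgt /= au av.
  by rewrite {2}uv2; case: u v {lu lv au av uv2} => [u1 u2] [].
- move=> m [x s] w [/= sw tw].
  exists (w, unt (unts m (s : chaotic S 0))); last exact: homotopic_refl.
  have uE : unts m ((x, s) : prod_ocat X (chaotic S) 0) = (unts m x, unts m (s : chaotic S 0)).
    exact: prod_srcs.
  by split; rewrite uE; [apply: congr2 sw (src_unt _) | apply: congr2 tw (tgt_unt _)].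
Qed.

(** * Reduction at an object and conjugation by paths *)

Section Reduced.
Variables (X : ocat) (x : X 0).

(** From dimension 2 on, only the boundary is constrained: all iterated faces of dimension 1 must be
    the unit of [x]. The predicate of dimension [n'] is passed to the inner match as an argument so
    that the recursion is structural. *)
Fixpoint reduced n : X n -> Prop :=
  match n with
  | 0 => fun u => u = x
  | n'.+1 => match n' return (X n' -> Prop) -> X n'.+1 -> Prop with
    | 0 => fun _ u => u = unt x
    | _ => fun red u => red (src u) /\ red (tgt u)
    end (@reduced n')
  end.

Lemma reduced_src n (u : X n.+1) : reduced u -> reduced (src u).
Proof. by case: n u => [|n] u; [move=> ->; rewrite /= src_unt | case]. Qed.

Lemma reduced_tgt n (u : X n.+1) : reduced u -> reduced (tgt u).
Proof. by case: n u => [|n] u; [move=> ->; rewrite /= tgt_unt | case]. Qed.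

Lemma reduced_unt n (u : X n) : reduced u -> reduced (unt u).
Proof.
case: n u => [|n] u ru; first by rewrite /= ru.
by split; rewrite ?src_unt ?tgt_unt.
Qed.

Lemma reduced_unts n : reduced (unts n x).
Proof. by elim: n => [|n IH] //; rewrite unts_unt //; apply: reduced_unt. Qed.

Lemma reduced_comp n j (v u : X n) : j < n -> composable j v u ->
  reduced v -> reduced u -> reduced (comp j v u).
Proof.
elim: n v u => // -[|n] IH v u.
  rewrite ltnS leqn0 => /eqP -> _ /= -> ->; apply: comp_unit => //.
  by rewrite srcsS src_unt untsS.
rewrite ltnS leq_eqVlt => /predU1P[-> vu [_ rv] [ru _]|ji vu [rv rv'] [ru ru']].
  by split; rewrite ?src_comp_top ?tgt_comp_top.
split; rewrite ?src_comp ?tgt_comp //; apply: IH => //.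
  exact: composable_src.
exact: composable_tgt.
Qed.

Lemma reduced_inv n j (u v : X n) : j < n -> reduced u ->
  srcs j v = tgts j u -> tgts j v = srcs j u ->
  comp j u v = unts n (tgts j u) -> comp j v u = unts n (srcs j u) -> reduced v.
Proof.
elim: n u v => // -[|n] IH u v.
  rewrite ltnS leqn0 => /eqP -> /= -> sv tv uv _.
  move: uv; rewrite unit_comp // ?tv ?tgtsS ?srcsS ?src_unt ?tgt_unt ?untsS //.
rewrite ltnS leq_eqVlt => /predU1P[-> [ru1 ru2] sv tv _ _|ji [ru1 ru2] sv tv uv vu].
  by move: sv tv; rewrite !srcsS !tgtsS => sv tv; split; rewrite ?sv ?tv.
have cuv : composable j u v by apply/esym.
have cvu : composable j v u by [].
split.
- apply: (IH (src u)) => //.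
  + by rewrite srcs_src 1?ltnW // tgts_src.
  + by rewrite tgts_src // srcs_src 1?ltnW.
  + by rewrite -src_comp // uv src_unts 1?ltnW // tgts_src.
  + by rewrite -src_comp // vu src_unts 1?ltnW // srcs_src // ltnW.
- apply: (IH (tgt u)) => //.
  + by rewrite srcs_tgt // tgts_tgt 1?ltnW.
  + by rewrite tgts_tgt 1?ltnW // srcs_tgt.
  + by rewrite -tgt_comp // uv tgt_unts 1?ltnW // tgts_tgt // ltnW.
  + by rewrite -tgt_comp // vu tgt_unts 1?ltnW // srcs_tgt.
Qed.

Lemma reduced_bd1 n (u : X n.+1) : reduced u -> srcs 1 u = unt x /\ tgts 1 u = unt x.
Proof.
elim: n u => [|n IH] u; first by move=> ->; rewrite srcs_id tgts_id.
move=> [/IH[s _] /IH[_ t]].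
by rewrite -(@srcs_src X) // -(@tgts_tgt X) // s t.
Qed.

Lemma reduced_bd0 n (u : X n.+1) : reduced u -> srcs 0 u = x /\ tgts 0 u = x.
Proof.
move=> /reduced_bd1[s t].
by rewrite -(@srcs_srcs _ _ 1) // -(@tgts_tgts _ _ 1) // s t srcsS tgtsS src_unt tgt_unt.
Qed.

Definition reduction : ocat :=
  sub_ocat reduced_src reduced_tgt reduced_unt reduced_comp.

Definition reduction_incl : ofun reduction X :=
  sub_incl reduced_src reduced_tgt reduced_unt reduced_comp.

Lemma reduction_groupoid : is_groupoid X -> is_groupoid reduction.
Proof. by apply: sub_groupoid => n j u v; apply: reduced_inv. Qed.

Lemma reduction_inj n (u v : reduction n) : sval u = sval v -> u = v.
Proof. exact: sub_cell_inj. Qed.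

Lemma reduction_eq0 (u v : reduction 0) : u = v.
Proof. by apply: reduction_inj; case: u v => [u /= ->] [v /= ->]. Qed.

Lemma reduction_eq1 (u v : reduction 1) : u = v.
Proof. by apply: reduction_inj; case: u v => [u /= ->] [v /= ->]. Qed.

Definition reduction_base : reduction 0 := exist (fun u : X 0 => u = x) x erefl.

(** A homotopy between reduced cells of positive dimension, and a loop at [x] of dimension at least
    2, have reduced faces and so are themselves reduced. Only connectedness and loops of dimension 1
    call for the hypotheses. *)
Lemma reduction_incl_weq :
  (forall y : X 0, homotopic x y) ->
  (forall l : X 1, is_loop (m := 0) x l -> homotopic (unt x) l) ->
  weq reduction_incl.
Proof.
move=> conn sc.
have sunts m : sval (unts m reduction_base) = unts m x.
  exact: (ofn_unts reduction_incl).
split.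
- by move=> y z _; rewrite (reduction_eq0 y z); apply: homotopic_refl.
- by move=> y; exists reduction_base.
- move=> m y u v _ _ [a [/= au av]].
  have ra : reduced a.
    by case: m u v a au av => [|m] u v a au av; split; rewrite ?au ?av; exact: proj2_sig.
  by exists (exist _ a ra); split; apply: reduction_inj.
(* In dimension 1 the only available preimage is the unit, and [sc] contracts [w] to it. *)
- move=> [|m] y w; rewrite (reduction_eq0 y reduction_base) => -[/= sw tw].
    exists (unt reduction_base); last exact: sc.
    by split; apply: reduction_inj; rewrite /= ?src_unt ?tgt_unt.
  have rw : reduced w by split; rewrite ?sw ?tw; apply: (reduced_unts m.+1).
  exists (exist _ w rw); last exact: homotopic_refl.
  by split; apply: reduction_inj; rewrite sunts.
Qed.

End Reduced.

(** An invertible 1-arrow; the inverse is part of the data, so that conjugation by a path is an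
    explicit formula. *)
Record path (X : ocat) (y z : X 0) := Path {
  fwd : X 1; bwd : X 1;
  src_fwd : src fwd = y; tgt_fwd : tgt fwd = z;
  src_bwd : src bwd = z; tgt_bwd : tgt bwd = y;
  fwd_bwd : comp 0 fwd bwd = unt z;
  bwd_fwd : comp 0 bwd fwd = unt y }.

Lemma homotopic_path (X : ocat) (y z : X 0) : is_groupoid X -> homotopic y z ->
  inhabited (path y z).
Proof.
move=> gX [p [sp tp]]; have [q [sq tq pq qp]] := gX _ 0 p isT.
move: sq tq pq qp; rewrite !srcsS !tgtsS !untsS sp tp => sq tq pq qp.
by split; exists p q.
Qed.

Section Paths.
Variable X : ocat.

Definition path_unt (y : X 0) : path y y.
Proof.
by exists (unt y) (unt y); rewrite ?src_unt ?tgt_unt //; apply: comp_unit;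
  rewrite // srcsS src_unt untsS.
Defined.

Definition path_inv (y z : X 0) (p : path y z) : path z y.
Proof. by case: p => f b *; exists b f. Defined.

Definition path_cast (y y' z : X 0) (e : y = y') (p : path y z) : path y' z.
Proof. by case: p => f b *; exists f b; rewrite // -e. Defined.

Lemma composable01 (q p : X 1) : src q = tgt p -> composable 0 q p.
Proof. exact: composableS. Qed.

Lemma comp0_middle (f f' b' b : X 1) (y : X 0) :
  src f = y -> src f = tgt f' -> src f' = tgt b' -> src b' = tgt b -> tgt b = y ->
  comp 0 f' b' = unt y -> comp 0 (comp 0 f f') (comp 0 b' b) = comp 0 f b.
Proof.
move=> sf sff' sfb' sbb' tb fb.
have c1 : composable 0 f f' by apply: composable01.
have c2 : composable 0 f' b' by apply: composable01.
have c3 : composable 0 b' b by apply: composable01.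
have c4 : composable 0 f' (comp 0 b' b).
  by apply: composable01; rewrite tgt_comp_top.
rewrite compA // -(@compA X 1 0 f' b' b) // fb; congr comp.
by apply: unit_comp; rewrite // tgtsS tb untsS.
Qed.

Lemma composable_fwd_fwd (w y z : X 0) (q : path y z) (p : path w y) :
  composable 0 (fwd q) (fwd p).
Proof. by apply: composable01; rewrite src_fwd tgt_fwd. Qed.

Lemma composable_bwd_bwd (w y z : X 0) (q : path y z) (p : path w y) :
  composable 0 (bwd p) (bwd q).
Proof. by apply: composable01; rewrite src_bwd tgt_bwd. Qed.

Definition path_comp (w y z : X 0) (q : path y z) (p : path w y) : path w z.
Proof.
exists (comp 0 (fwd q) (fwd p)) (comp 0 (bwd p) (bwd q)).
- by rewrite src_comp_top ?src_fwd //; apply: composable_fwd_fwd.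
- by rewrite tgt_comp_top ?tgt_fwd //; apply: composable_fwd_fwd.
- by rewrite src_comp_top ?src_bwd //; apply: composable_bwd_bwd.
- by rewrite tgt_comp_top ?tgt_bwd //; apply: composable_bwd_bwd.
- by rewrite (@comp0_middle _ _ _ _ y) ?fwd_bwd ?src_fwd ?tgt_fwd ?src_bwd ?tgt_bwd.
- by rewrite (@comp0_middle _ _ _ _ y) ?bwd_fwd ?src_fwd ?tgt_fwd ?src_bwd ?tgt_bwd.
Defined.

End Paths.

Definition path_map (X Y : ocat) (f : ofun X Y) (y z : X 0) (p : path y z) :
  path (ofn f y) (ofn f z).
Proof.
exists (ofn f (fwd p)) (ofn f (bwd p)).
- by rewrite -ofn_src src_fwd.
- by rewrite -ofn_tgt tgt_fwd.
- by rewrite -ofn_src src_bwd.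
- by rewrite -ofn_tgt tgt_bwd.
- rewrite -ofn_comp ?fwd_bwd ?ofn_unt //.
  by apply: composable01; rewrite src_fwd tgt_bwd.
- rewrite -ofn_comp ?bwd_fwd ?ofn_unt //.
  by apply: composable01; rewrite src_bwd tgt_fwd.
Defined.

(** * Conjugation of cells by 1-arrows *)

Section Sandwich.
Variable X : ocat.

(** The two arrows are independent, because a cell running along the cylinder is conjugated by
    different paths at its two ends. *)
Definition sandwich n (f b : X 1) (u : X n.+1) : X n.+1 :=
  comp 0 (comp 0 (unts n.+1 f) u) (unts n.+1 b).

Definition sandwichable n (f b : X 1) (u : X n.+1) : Prop :=
  src f = tgts 0 u /\ srcs 0 u = tgt b.

Lemma composable_fwd n (f : X 1) (u : X n.+1) : src f = tgts 0 u ->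
  composable 0 (unts n.+1 f) u.
Proof. by move=> fu; apply/composableP; rewrite srcs_unts_low // srcsS. Qed.

Lemma composable_bwd n (f b : X 1) (u : X n.+1) : sandwichable f b u ->
  composable 0 (comp 0 (unts n.+1 f) u) (unts n.+1 b).
Proof.
move=> [fu ub]; apply/composableP.
by rewrite srcs_comp_low ?tgts_unts_low ?tgtsS //; apply: composable_fwd.
Qed.

Lemma srcs0_sandwich n f b (u : X n.+1) : sandwichable f b u ->
  srcs 0 (sandwich f b u) = src b.
Proof.
move=> fub; rewrite srcs_comp_low //; last exact: composable_bwd.
by rewrite srcs_unts_low // srcsS.
Qed.

Lemma tgts0_sandwich n f b (u : X n.+1) : sandwichable f b u ->
  tgts 0 (sandwich f b u) = tgt f.
Proof.
move=> fub; rewrite tgts_comp_low //; last exact: composable_bwd.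
rewrite tgts_comp_low ?tgts_unts_low ?tgtsS //; apply: composable_fwd.
by case: fub.
Qed.

Lemma src_sandwich n f b (u : X n.+2) : sandwichable f b u ->
  src (sandwich f b u) = sandwich f b (src u).
Proof.
move=> fub; rewrite src_comp //; last exact: composable_bwd.
rewrite src_comp ?src_unts //; apply: composable_fwd.
by case: fub.
Qed.

Lemma tgt_sandwich n f b (u : X n.+2) : sandwichable f b u ->
  tgt (sandwich f b u) = sandwich f b (tgt u).
Proof.
move=> fub; rewrite tgt_comp //; last exact: composable_bwd.
rewrite tgt_comp ?tgt_unts //; apply: composable_fwd.
by case: fub.
Qed.

Lemma unt_sandwich n f b (u : X n.+1) : sandwichable f b u ->
  unt (sandwich f b u) = sandwich f b (unt u).
Proof.
move=> fub; rewrite unt_comp //; last exact: composable_bwd.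
rewrite unt_comp // /sandwich ?[unts n.+2 _]unts_unt //.
by apply: composable_fwd; case: fub.
Qed.

(** The iterated unit of a 1-arrow is idempotent for composition along a positive dimension, so two
    applications of the exchange law merge the outer factors. *)
Lemma comp_sandwich n j f b (v u : X n.+1) : j.+1 < n.+1 ->
  sandwichable f b v -> sandwichable f b u -> composable j.+1 v u ->
  comp j.+1 (sandwich f b v) (sandwich f b u) = sandwich f b (comp j.+1 v u).
Proof.
move=> jn fbv fbu vu; have [fv vb] := fbv; have [fu ub] := fbu.
have cE (e : X 1) : composable j.+1 (unts n.+1 e) (unts n.+1 e).
  by apply/composableP; rewrite srcs_unts ?tgts_unts // ltnW.
have E (e : X 1) : comp j.+1 (unts n.+1 e) (unts n.+1 e) = unts n.+1 e.
  by apply: comp_unit; rewrite // srcs_unts ?unts_unts // ltnW.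
have cfv := composable_fwd fv; have cfu := composable_fwd fu.
have cPvu : composable j.+1 (comp 0 (unts n.+1 f) v) (comp 0 (unts n.+1 f) u).
  have jn' := ltnW jn; apply/composableP; rewrite srcs_comp // tgts_comp //.
  by move: (cE f) vu => /composableP -> /composableP ->.
rewrite /sandwich -exchange //; last exact: composable_bwd.
rewrite E; congr comp; rewrite -exchange ?E //.
Qed.

Lemma unts_comp01 n (q p : X 1) : composable 0 q p ->
  unts n.+1 (comp 0 q p) = comp 0 (unts n.+1 q) (unts n.+1 p).
Proof.
move=> qp; elim: n => [|n IH]; first by rewrite !unts_id.
rewrite unts_unt // IH unt_comp ?[unts n.+2 _]unts_unt //.
by apply/composableP; rewrite srcs_unts_low ?tgts_unts_low.
Qed.

(** Along objects the two conjugates are juxtaposed, and the inner factors [b] and [f'] cancel. *)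
Lemma comp0_sandwich n f b f' b' (v u : X n.+1) (y : X 0) :
  sandwichable f b v -> sandwichable f' b' u ->
  src b = tgt f' -> comp 0 b f' = unt y -> srcs 0 v = tgts 0 u -> srcs 0 v = y ->
  comp 0 (sandwich f b v) (sandwich f' b' u) = sandwich f b' (comp 0 v u).
Proof.
move=> fbv fbu bf' bfy vu vy; have [fv vb] := fbv; have [fu ub] := fbu.
have cFv := composable_fwd fv; have cFu := composable_fwd fu.
have cFvB := composable_bwd fbv; have cFuB := composable_bwd fbu.
have cBF : composable 0 (unts n.+1 b) (unts n.+1 f').
  by apply/composableP; rewrite srcs_unts_low ?tgts_unts_low ?srcsS ?tgtsS.
have cBFu : composable 0 (unts n.+1 b) (comp 0 (unts n.+1 f') u).
  by apply/composableP; rewrite tgts_comp_low.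
have cvu : composable 0 v u by [].
have key : comp 0 (unts n.+1 b) (comp 0 (unts n.+1 f') u) = u.
  rewrite -compA // -unts_comp01; last exact: composable01.
  by apply: unit_comp; rewrite // bfy -vu vy -untsS unts_unts.
rewrite /sandwich -[LHS]compA //; last by apply/composableP; rewrite srcs_comp_low.
by congr (comp 0 _ _); rewrite compA // key compA.
Qed.

Lemma sandwich_sandwich n f b f' b' (u : X n.+1) :
  sandwichable f' b' u -> src f = tgt f' -> src b' = tgt b ->
  sandwich f b (sandwich f' b' u) = sandwich (comp 0 f f') (comp 0 b' b) u.
Proof.
move=> fbu ff' bb'; have [fu ub] := fbu.
have cff : composable 0 f f' by exact: composable01.
have cbb : composable 0 b' b by exact: composable01.
have cFu := composable_fwd fu; have cFuB := composable_bwd fbu.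
have cFF : composable 0 (unts n.+1 f) (unts n.+1 f').
  by apply/composableP; rewrite srcs_unts_low ?tgts_unts_low ?srcsS ?tgtsS.
have cBB : composable 0 (unts n.+1 b') (unts n.+1 b).
  by apply/composableP; rewrite srcs_unts_low ?tgts_unts_low ?srcsS ?tgtsS.
have cFFu : composable 0 (unts n.+1 f) (comp 0 (unts n.+1 f') u).
  by apply/composableP; rewrite tgts_comp_low.
rewrite /sandwich !unts_comp01 // -[in LHS]compA // -[in LHS]compA //.
rewrite compA //; apply/composableP.
rewrite [LHS]srcs_comp_low //; last by apply/composableP; rewrite srcs_comp_low.
by rewrite tgts_unts_low.
Qed.

Lemma sandwich_unt n (y : X 0) (u : X n.+1) :
  tgts 0 u = y -> srcs 0 u = y -> sandwich (unt y) (unt y) u = u.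
Proof.
move=> tu su; have e : unts n.+1 (unt y) = unts n.+1 y by rewrite -untsS unts_unts.
rewrite /sandwich e [comp 0 _ u]unit_comp ?tu //.
by apply: comp_unit; rewrite // su.
Qed.

End Sandwich.

Lemma ofn_sandwich (X Y : ocat) (F : ofun X Y) n f b (u : X n.+1) :
  sandwichable f b u ->
  ofn F (sandwich f b u) = sandwich (ofn F f) (ofn F b) (ofn F u).
Proof.
move=> fbu; rewrite /sandwich ofn_comp //; last exact: composable_bwd.
rewrite ofn_comp ?ofn_unts //; apply: composable_fwd.
by case: fbu.
Qed.

Section Whisker.
Variables (A H : ocat) (F : ofun A H) (x : A 0).
Hypothesis eqA0 : forall y : A 0, y = x.
Variables (S : Type) (z : S -> H 0) (p : forall s, path (ofn F x) (z s)).

(** A cell over the arrow from [s] to [t] goes back along [p s], through the image of [F], and out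
    along [p t]; the 0-source [s] is the first component of the chaotic cell. *)
Definition whisker_cell n : prod_cell A (chaotic S) n -> H n :=
  match n return prod_cell A (chaotic S) n -> H n with
  | 0 => fun u => z u.2
  | n'.+1 => fun u => sandwich (fwd (p u.2.2)) (bwd (p u.2.1)) (ofn F u.1)
  end.

Lemma whisker_sandwichable n (u : A n.+1) s t :
  sandwichable (fwd (p s)) (bwd (p t)) (ofn F u).
Proof.
split; first by rewrite -ofn_tgts (eqA0 (tgts 0 u)) src_fwd.
by rewrite -ofn_srcs (eqA0 (srcs 0 u)) tgt_bwd.
Qed.
Hint Resolve whisker_sandwichable : core.

(* All the conjugates of [F] by the paths [p s] at once, together with the
   natural isomorphisms between them. *)
Definition whisker : ofun (prod_ocat A (chaotic S)) H.
Proof.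
exists whisker_cell.
- move=> [|n] [u [s t]].
    by rewrite -[RHS]srcsS srcs0_sandwich // src_bwd.
  by rewrite [RHS]src_sandwich // -ofn_src.
- move=> [|n] [u [s t]].
    by rewrite -[RHS]tgtsS tgts0_sandwich // tgt_fwd.
  by rewrite [RHS]tgt_sandwich // -ofn_tgt.
- move=> [|n] [u s]; last by rewrite [RHS]unt_sandwich // -ofn_unt.
  rewrite (eqA0 u).
  transitivity (sandwich (fwd (p s)) (bwd (p s)) (unt (ofn F x))).
    by rewrite -ofn_unt.
  rewrite /sandwich !unts_id [comp 0 (fwd _) _]comp_unit ?fwd_bwd //.
  by rewrite srcsS src_fwd untsS.
- move=> [|n] [|j] // [v [s t]] [u [s' t']] jn.
    move=> c; have [vu e] := @prod_composable A (chaotic S) _ _ _ _ c.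
    (* Composability along objects says that [v] starts at the end where [u] arrives, so the inner
       [bwd (p s)] and [fwd (p s)] cancel. *)
    have {}e : s = t' := etrans (esym (chaotic_srcs0 _)) (etrans e (chaotic_tgts0 _)).
    subst t'; rewrite [RHS](@comp0_sandwich _ _ _ _ _ _ _ _ (ofn F x)) //.
    + by rewrite -ofn_comp.
    + by rewrite src_bwd tgt_fwd.
    + by rewrite bwd_fwd.
    + exact: (ofn_composable F vu).
    + by rewrite -ofn_srcs (eqA0 (srcs 0 v)).
  move=> c; have [vu e] := @prod_composable A (chaotic S) _ _ _ _ c.
  (* Along a positive dimension the chaotic components coincide, so both cells are conjugated by the
     same pair of paths. *)
  have [-> ->] : (s, t) = (s', t') :=
    etrans (esym (@chaotic_srcsS S n j (s, t)))
           (etrans e (@chaotic_tgtsS S n j (s', t'))).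
  rewrite [RHS]comp_sandwich //; last exact: (ofn_composable F vu).
  by rewrite -ofn_comp.
Defined.

End Whisker.

Section ReductionMap.
Variables (G H : ocat) (x : G 0) (z : H 0) (f : ofun G H) (p : path (ofn f x) z).

Lemma reduction_base_eq (y : reduction x 0) : y = reduction_base x.
Proof. exact: reduction_eq0. Qed.

Let zs (s : bool) := if s then z else ofn f x.

Let ps (s : bool) : path (ofn f x) (zs s) :=
  if s return path (ofn f x) (zs s) then p else path_unt (ofn f x).

(** The path is the unit at the end [false] and [p] at the end [true]: this joins the restriction of
    [f] to its conjugate by [p]. *)
Definition reduction_homotopy : ofun (prod_ocat (reduction x) (chaotic bool)) H :=
  @whisker _ _ (ofun_comp f (reduction_incl x)) _ reduction_base_eq bool zs ps.

Definition cylinder_end (X : ocat) (s : bool) : ofun X (prod_ocat X (chaotic bool)) :=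
  prod_pair (ofun_id X) (chaotic_point X s).

(** The source of [M] has a single object and a single 1-arrow, the latter a unit, so the images of
    all higher cells have trivial 1-boundary at [z]. *)
Lemma reduced_ofn (M : ofun (reduction x) H) : ofn M (reduction_base x) = z ->
  forall n (u : reduction x n), reduced z (ofn M u).
Proof.
move=> Mz n; elim: n => [|n IH] u; first by rewrite (reduction_base_eq u).
case: n IH u => [|n] IH u; last by split; rewrite -?ofn_src -?ofn_tgt; apply: IH.
by rewrite (reduction_eq1 u (unt (reduction_base x))) ofn_unt Mz.
Qed.

(** Conjugation by [p], taken as the end [true] of the homotopy: compatibility with the structure
    comes from [whisker], and the relation to the homotopy holds by computation. *)
Definition reduction_map : ofun (reduction x) (reduction z) :=
  corestrict (@reduced_src _ z) (@reduced_tgt _ z) (@reduced_unt _ z) (@reduced_comp _ z)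
    (@reduced_ofn (ofun_comp reduction_homotopy (cylinder_end _ true)) erefl).

Lemma reduction_mapE n (u : reduction x n.+1) :
  sval (ofn reduction_map u) = sandwich (fwd p) (bwd p) (ofn f (sval u)).
Proof. by []. Qed.

Lemma reduction_homotopy1 n (u : reduction x n) :
  sval (ofn reduction_map u) = ofn reduction_homotopy (ofn (cylinder_end _ true) u).
Proof. by []. Qed.

Lemma ofn_reduced_bd0 n (u : reduction x n.+1) :
  srcs 0 (ofn f (sval u)) = ofn f x /\ tgts 0 (ofn f (sval u)) = ofn f x.
Proof. by rewrite -ofn_srcs -ofn_tgts; have [-> ->] := reduced_bd0 (proj2_sig u). Qed.

Lemma reduction_homotopy0 n (u : reduction x n) :
  ofn f (sval u) = ofn reduction_homotopy (ofn (cylinder_end _ false) u).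
Proof.
case: n u => [|n] u; first by rewrite (reduction_base_eq u).
by have [s t] := ofn_reduced_bd0 u; rewrite [RHS]sandwich_unt.
Qed.

End ReductionMap.

Section PathIndependence.
Variables (X : ocat) (gX : is_groupoid X) (y z : X 0).
Hypothesis sc : forall l : X 1, is_loop (m := 0) y l -> homotopic l (unt y).

(** The two conjugations differ by conjugation with the loop [l] obtained by following [p] and then
    [q] backwards. A 2-arrow contracts [l], so [l] commutes with [u] by [source_comm] and
    conjugation by it fixes [u]. *)
Lemma sandwich_path n (p q : path y z) (u : X n.+1) :
  reduced y u -> sandwich (fwd p) (bwd p) u = sandwich (fwd q) (bwd q) u.
Proof.
case: p q => [f b sf tf sb tb fb bf] [f' b' sf' tf' sb' tb' fb' bf'] /=.
case: n u => [|n] u ru.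
  by rewrite ru /sandwich !unts_id ![comp 0 _ (unt y)]comp_unit ?srcsS ?sf ?sf' ?untsS // fb.
have [s1 t1] := @reduced_bd1 X y _ u ru.
have [s0 t0] := @reduced_bd0 X y _ u ru.
have sbu : sandwichable f b u by rewrite /sandwichable sf tb.
have sbu' : sandwichable f' b' u by rewrite /sandwichable sf' tb'.
have cbf : composable 0 b' f by apply: composable01; rewrite sb'.
have cfb : composable 0 b f' by apply: composable01; rewrite sb.
pose l := comp 0 b' f; pose l' := comp 0 b f'.
have sl : src l = y by rewrite src_comp_top.
have tl : tgt l = y by rewrite tgt_comp_top.
have sl' : src l' = y by rewrite src_comp_top.
have tl' : tgt l' = y by rewrite tgt_comp_top.
have ll' : comp 0 l l' = unt y.
  by rewrite (@comp0_middle _ _ _ _ _ z) ?sb' ?tf ?sf ?tb ?sb ?tf'.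
have [B [sB tB]] := sc (conj sl tl).
have lu : comp 0 (unts n.+2 l) u = comp 0 u (unts n.+2 l).
  (* The contraction [B], raised to the dimension of [u] by units, keeps the 1-source [l] and the
     1-target [unt y]. *)
  have <- : srcs 1 (unts n.+2 B) = l by rewrite srcs_unts_low // srcsS.
  apply: source_comm (t1) _ _ gX => //.
  - by rewrite srcs_unts_low // -(@srcs_src X) // srcsS sB sl.
  - by rewrite tgts_unts_low // tgtsS.
have lul : sandwich l l' u = u.
  rewrite /sandwich lu compA //.
  - rewrite -unts_comp01 ?ll'; last by apply: composable01; rewrite sl.
    by apply: comp_unit; rewrite // s0 -untsS unts_unts.
  - by apply/composableP; rewrite tgts_unts_low // s0 tgtsS tl.
  - by apply/composableP; rewrite srcs_unts_low // tgts_unts_low // srcsS tgtsS sl.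
(* Conjugating by the inverse of [q] and then by [q] changes nothing; regrouped, the inner two
   conjugations become the one by [l]. *)
have pu : sandwich f' b' (sandwich b' f' (sandwich f b u)) = sandwich f b u.
  rewrite sandwich_sandwich ?fb' ?sf' ?tb' //.
    by rewrite sandwich_unt ?tgts0_sandwich ?srcs0_sandwich.
  by rewrite /sandwichable tgts0_sandwich ?srcs0_sandwich ?sb' ?tf ?sb ?tf'.
rewrite -pu; congr sandwich; rewrite sandwich_sandwich ?sb' ?tf ?sb ?tf' //.
Qed.

End PathIndependence.

(** * The 1-reduction functor *)

Section MapLaws.

Lemma sandwichable_path (X : ocat) n (y z z' : X 0) (p : path y z) (q : path y z')
    (u : X n.+1) :
  srcs 0 u = y -> tgts 0 u = y -> sandwichable (fwd p) (bwd q) u.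
Proof. by move=> su tu; split; rewrite ?src_fwd ?tgt_bwd. Qed.

(** By path independence an arbitrary loop [p] may be replaced by the unit path, which conjugates
    trivially. *)
Lemma reduction_map_id (X : ocat) (gX : is_groupoid X) (x : X 0)
    (sc : forall l : X 1, is_loop (m := 0) x l -> homotopic l (unt x))
    (p : path (ofn (ofun_id X) x) x) n (u : reduction x n) :
  ofn (reduction_map p) u = u.
Proof.
case: n u => [|n] u; first exact: reduction_eq0.
apply: reduction_inj; rewrite reduction_mapE.
rewrite [LHS](sandwich_path gX sc p (path_unt x) (proj2_sig u)).
by have [s t] := reduced_bd0 (proj2_sig u); apply: sandwich_unt.
Qed.

Variables (X Y Z : ocat) (x : X 0) (y : Y 0) (z : Z 0).

Lemma reduction_map_eq (f g : ofun X Y) (p : path (ofn f x) y) (q : path (ofn g x) y) :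
  is_groupoid Y ->
  (forall l : Y 1, is_loop (m := 0) (ofn f x) l -> homotopic l (unt (ofn f x))) ->
  (forall n (u : X n), ofn f u = ofn g u) ->
  forall n (u : reduction x n), ofn (reduction_map p) u = ofn (reduction_map q) u.
Proof.
move=> gY sc fg [|n] u; first exact: reduction_eq0.
apply: reduction_inj; rewrite !reduction_mapE -(fg _ (sval u)).
(* The maps [f] and [g] agree only pointwise, so the starting point of [q] is rewritten before the
   two paths are compared. *)
pose q' := path_cast (esym (fg _ x)) q.
have ru : reduced (ofn f x) (ofn f (sval u)).
  exact: (reduced_ofn (M := ofun_comp f (reduction_incl x))).
rewrite (sandwich_path gY sc p q' ru) /q'.
by case: (q).
Qed.

Lemma reduction_map_comp (g : ofun Y Z) (f : ofun X Y) (q : path (ofn g y) z)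
    (p : path (ofn f x) y) (r : path (ofn (ofun_comp g f) x) z) :
  is_groupoid Z ->
  (forall l : Z 1, is_loop (m := 0) (ofn g (ofn f x)) l ->
     homotopic l (unt (ofn g (ofn f x)))) ->
  forall n (u : reduction x n),
  ofn (reduction_map r) u = ofn (reduction_map q) (ofn (reduction_map p) u).
Proof.
move=> gZ sc [|n] u; first exact: reduction_eq0.
(* Conjugating by [p], applying [g] and conjugating by [q] is conjugating by this composite path,
   which path independence lets replace [r]. *)
pose q' := path_comp q (path_map g p).
apply: reduction_inj; rewrite !reduction_mapE.
have ru : reduced (ofn g (ofn f x)) (ofn g (ofn f (sval u))).
  exact: (reduced_ofn (M := ofun_comp (ofun_comp g f) (reduction_incl x))).
rewrite [LHS](sandwich_path gZ sc r q' ru) /q'.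
have [s t] := ofn_reduced_bd0 f u; have [s' t'] := ofn_reduced_bd0 (ofun_comp g f) u.
rewrite ofn_sandwich; last exact: sandwichable_path.
rewrite sandwich_sandwich //.
- by split; rewrite -?ofn_src -?ofn_tgt ?src_fwd ?tgt_bwd.
- by rewrite -ofn_tgt src_fwd tgt_fwd.
- by rewrite -ofn_src tgt_bwd src_bwd.
Qed.

End MapLaws.

Section Base.
Variable G : oGpd_sc.

Definition sc_ocat : ocat := sval (sval G).

Lemma sc_groupoid : is_groupoid sc_ocat.
Proof. exact: proj2_sig (sval G). Qed.

Lemma sc_connected (x y : sc_ocat 0) : homotopic x y.
Proof. by have [_ [c _]] := proj2_sig G; apply: c. Qed.

Lemma sc_loop (x : sc_ocat 0) (l : sc_ocat 1) :
  is_loop (m := 0) x l -> homotopic l (unt x).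
Proof.
move=> ll; have [_ [_ s]] := proj2_sig G.
have lu : is_loop (m := 0) x (unt x) by split; rewrite ?src_unt ?tgt_unt.
exact: (s x (exist _ l ll) (exist _ (unt x) lu)).
Qed.

Lemma sc_nonempty : exists x : sc_ocat 0, True.
Proof. by have [[x] _] := proj2_sig G; exists x. Qed.

Definition sc_base : sc_ocat 0 := sval (cid sc_nonempty).

End Base.

Definition reduce_gpd (G : oGpd) (x : gcell G 0) : oGpd :=
  exist (fun X : oCat => is_groupoid X) (reduction x : oCat)
    (reduction_groupoid (proj2_sig G)).

Lemma reduce_one_reduced (G : oGpd) (x : gcell G 0) : one_reduced (reduce_gpd x).
Proof.
split; first by exists (reduction_base x) => y; apply: reduction_eq0.
by exists (unt (reduction_base x)) => u; apply: reduction_eq1.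
Qed.

Definition reduce_obj (G : oGpd_sc) : oGpd_ge2 :=
  exist _ (reduce_gpd (G := sval G) (sc_base G)) (reduce_one_reduced (sc_base G)).

Lemma sc_path (H : oGpd_sc) (x y : sc_ocat H 0) : exists p : path x y, True.
Proof.
by have [p] := homotopic_path (@sc_groupoid H) (sc_connected x y); exists p.
Qed.

Definition base_path (G H : oGpd_sc) (f : hom G H) :
    path (ofn (f : ofun (sc_ocat G) (sc_ocat H)) (sc_base G)) (sc_base H) :=
  sval (cid (sc_path _ _)).

Definition reduce_mor (G H : oGpd_sc) (f : hom G H) : hom (reduce_obj G) (reduce_obj H) :=
  reduction_map (base_path f).

Definition reduce : functor oGpd_sc oGpd_ge2.
Proof.
exists reduce_obj reduce_mor.
- move=> G H f g fg.
  exact: (reduction_map_eq _ _ (@sc_groupoid H) (@sc_loop H _) fg).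
- move=> G; exact: (reduction_map_id (@sc_groupoid G) (@sc_loop G _)).
- move=> G H K g f.
  exact: (reduction_map_comp _ _ _ (@sc_groupoid K) (@sc_loop K _)).
Defined.

Definition reduce_incl (G : oGpd_sc) : hom (ge2_incl (reduce G)) G :=
  reduction_incl (sc_base G).

Lemma reduce_incl_weq (G : oGpd_sc) : weq_sc (reduce_incl G).
Proof.
apply/(@weqP (reduce_gpd (G := sval G) (sc_base G)) (sval G)).
apply: reduction_incl_weq => [y|l ll]; first exact: sc_connected.
exact: (homotopic_sym (G := sval G) (sc_loop ll)).
Qed.

Lemma weq_sc_obj (X Y : oGpd) (f : ofun (gcell X) (gcell Y)) : weq f ->
  simply_connected Y -> simply_connected X.
Proof.
move=> wf [cY sY]; split; first by move=> x y; apply: (weq_inj0 wf); apply: cY.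
move=> x [u lu] [v lv]; apply: (weq_inj wf lu lv).
exact: (sY _ (exist _ _ (ofn_is_loop f lu)) (exist _ _ (ofn_is_loop f lv))).
Qed.

(** * Cylinders and homotopic morphisms in the localization *)

Definition cylinder_gpd (G : oGpd) : oGpd :=
  exist (fun X : oCat => is_groupoid X) (prod_ocat (gcell G) (chaotic bool) : oCat)
    (prod_groupoid (proj2_sig G) (chaotic_groupoid (S := bool))).

Lemma cylinder_sc (G : oGpd_sc) :
  inhabited (cylinder_gpd (sval G) 0) /\ simply_connected (cylinder_gpd (sval G)).
Proof.
have [[x] sG] := proj2_sig G; split; first exact: (inhabits (x, true)).
exact: (weq_sc_obj (X := cylinder_gpd (sval G)) (prod_chaotic_weq _ true) sG).
Qed.

Definition cylinder (G : oGpd_sc) : oGpd_sc := exist _ _ (cylinder_sc G).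

Definition cylinder_proj (G : oGpd_sc) : hom (cylinder G) G :=
  prod_fst (sc_ocat G) (chaotic bool).

Definition cylinder_at (G : oGpd_sc) (s : bool) : hom G (cylinder G) :=
  cylinder_end (sc_ocat G) s.

Lemma cylinder_proj_weq (G : oGpd_sc) : weq_sc (cylinder_proj G).
Proof.
apply/(@weqP (cylinder_gpd (sval G)) (sval G)); exact: (prod_chaotic_weq _ true).
Qed.

(** Each end is a section of the projection, which becomes invertible; hence each equals its inverse
    [r]. *)
Lemma cylinder_atE (G : oGpd_sc) s t :
  loc_eq (loc_in weq_sc (cylinder_at G s)) (loc_in weq_sc (cylinder_at G t)).
Proof.
have [r [rp _]] := loc_in_invertible_W (cylinder_proj_weq G).
have E s' : @heq (loc weq_sc) _ _ (loc_in weq_sc (cylinder_at G s')) r.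
  apply: heq_trans (heq_sym (cmpKm (_ : @hom (loc weq_sc) _ _) rp)) _.
  apply: heq_trans (cmpm1 r); apply: cmp_heqr.
  apply: loc_trans (loc_sym (loc_in_cmp _ _ _)) _; exact: loc_in_eq.
exact: heq_trans (E s) (heq_sym (E t)).
Qed.

Lemma homotopic_loc_eq (A H : oGpd_sc) (h : hom (cylinder A) H) (f g : hom A H) :
  heq f (cmp h (cylinder_at A false)) -> heq g (cmp h (cylinder_at A true)) ->
  loc_eq (loc_in weq_sc f) (loc_in weq_sc g).
Proof.
move=> fh gh; apply: loc_trans (loc_in_eq _ fh) _.
apply: loc_trans (loc_sym (loc_in_eq _ gh)).
apply: loc_trans (loc_in_cmp _ _ _) (loc_trans _ (loc_sym (loc_in_cmp _ _ _))).
exact: loc_cmp_eq (loc_refl _) (cylinder_atE _ _ _).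
Qed.

Lemma reduce_incl_natural (G H : oGpd_sc) (f : hom G H) :
  loc_eq (loc_in weq_sc (cmp f (reduce_incl G)))
    (loc_in weq_sc (cmp (reduce_incl H) (fmor ge2_incl (fmor reduce f)))).
Proof.
apply: (@homotopic_loc_eq (ge2_incl (reduce G)) H (reduction_homotopy (base_path f))).
  exact: reduction_homotopy0.
exact: reduction_homotopy1.
Qed.

(** The square of inclusions commutes strictly for the unit path, so the map is factored. The first
    factor [m] uses the unit path and is treated by cancellation; the second, [c], is conjugation by
    [p] inside [H], with inverse the conjugation by [path_inv p]. *)
Lemma reduction_map_weq (G H : oGpd_sc) (x : sc_ocat G 0) (y : sc_ocat H 0)
    (f : ofun (sc_ocat G) (sc_ocat H)) (p : path (ofn f x) y) :
  weq f -> weq (reduction_map p).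
Proof.
have gH := @sc_groupoid H; have sc := @sc_loop H.
have incl_weq (K : oGpd_sc) (w : sc_ocat K 0) : weq (reduction_incl w).
  apply: reduction_incl_weq => [v|l ll]; first exact: sc_connected.
  exact: (homotopic_sym (G := sval K) (sc_loop ll)).
move=> wf; pose x' := ofn f x.
pose m := reduction_map (path_unt x' : path (ofn f x) x').
have wm : weq m.
  apply: (weq_right_cancel (Z := sval H) (incl_weq H x')).
  apply: weq_eq (weq_comp (Z := sval H) (incl_weq G x) wf) => -[|n] u.
    by rewrite (reduction_base_eq u).
  by have [s t] := ofn_reduced_bd0 f u; rewrite [RHS]sandwich_unt.
pose c := reduction_map (p : path (ofn (ofun_id (sc_ocat H)) x') y).
pose c' := reduction_map (path_inv p : path (ofn (ofun_id (sc_ocat H)) y) x').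
have wc : weq c.
  apply: (@weq_bij _ _ c c') => n u.
    pose e : path (ofn (ofun_comp (ofun_id _) (ofun_id _)) x') x' := path_unt x'.
    rewrite -(reduction_map_comp _ _ e gH (sc _)).
    exact: (reduction_map_id gH (sc _)).
  pose e : path (ofn (ofun_comp (ofun_id _) (ofun_id _)) y) y := path_unt y.
  rewrite -(reduction_map_comp _ _ e gH (sc _)).
  exact: (reduction_map_id gH (sc _)).
apply: weq_eq (weq_comp (Z := reduce_gpd (G := sval H) y) wm wc) => n u.
pose p' : path (ofn (ofun_comp (ofun_id (sc_ocat H)) f) x) y := p.
transitivity (ofn (reduction_map p') u).
  exact/esym/(reduction_map_comp _ _ _ gH (sc _)).
exact: (reduction_map_eq _ _ gH (sc _)).
Qed.

Lemma reduce_weq : preserves weq_sc weq_ge2 reduce.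
Proof.
move=> G H f /(@weqP (sval G) (sval H)) wf.
apply/(@weqP (sval (reduce G)) (sval (reduce H))); exact: reduction_map_weq.
Qed.

(** * Reduction of 1-reduced groupoids and the left-hand equivalence *)

Definition ge2_ocat (G : oGpd_ge2) : ocat := sval (sval G).

Lemma ge2_eq0 (G : oGpd_ge2) (x y : ge2_ocat G 0) : x = y.
Proof. by have [[z zP] _] := proj2_sig G; rewrite (zP x) (zP y). Qed.

Lemma ge2_eq1 (G : oGpd_ge2) (x y : ge2_ocat G 1) : x = y.
Proof. by have [_ [z zP]] := proj2_sig G; rewrite (zP x) (zP y). Qed.

Lemma one_reduced_reduced (X : ocat) (x : X 0) : (forall y : X 0, y = x) ->
  (forall u : X 1, u = unt x) -> forall n (u : X n), reduced x u.
Proof.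
by move=> eq0 eq1; elim=> [//|[|n] IH] u; [apply: eq1 | split; apply: IH].
Qed.

(** Here every path is a unit, so conjugation is trivial and naturality holds strictly, before
    localization. *)
Lemma reduce_incl_ge2_natural (G H : oGpd_ge2) (f : hom G H) :
  heq (cmp (reduce_incl (ge2_incl H) : hom (reduce (ge2_incl H)) H)
           (fmor reduce (fmor ge2_incl f)))
      (cmp f (reduce_incl (ge2_incl G) : hom (reduce (ge2_incl G)) G)).
Proof.
move=> [|n] u; first exact: ge2_eq0.
set p := base_path (fmor ge2_incl f).
set y : ge2_ocat H 0 := sc_base (ge2_incl H).
have [s t] := ofn_reduced_bd0 (f : ofun (ge2_ocat G) (ge2_ocat H)) u.
transitivity (sandwich (fwd p) (bwd p) (ofn (f : ofun (ge2_ocat G) (ge2_ocat H)) (sval u))) => //.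
have eq1 (l l' : ge2_ocat H 1) : l = l' by apply: ge2_eq1.
rewrite (eq1 (fwd p) (unt y)) (eq1 (bwd p) (unt y)).
by apply: sandwich_unt; apply: ge2_eq0.
Qed.

(** Every cell of a 1-reduced groupoid is reduced, so the inclusion has an inverse, the corestricted
    identity. *)
Lemma reduce_ge2_incl : isomorphic_functors (functor_comp reduce ge2_incl) (functor_id oGpd_ge2).
Proof.
exists (fun G => reduce_incl (ge2_incl G) : hom (reduce (ge2_incl G)) G).
split=> [G H f|G]; first exact: reduce_incl_ge2_natural.
have eq0 (y : ge2_ocat G 0) : y = sc_base (ge2_incl G) by apply: ge2_eq0.
have eq1 (u : ge2_ocat G 1) : u = unt (sc_base (ge2_incl G)) by apply: ge2_eq1.
have all_reduced := one_reduced_reduced eq0 eq1.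
exists (corestrict (@reduced_src _ _) (@reduced_tgt _ _) (@reduced_unt _ _)
  (@reduced_comp _ _) (f := ofun_id (ge2_ocat G)) all_reduced).
by split=> n u; [apply: reduction_inj | ].
Qed.

(** One composite is isomorphic to the identity already before localization; the other becomes so
    because the weak equivalences [reduce_incl] are inverted and natural in the localization. *)
Lemma ge2_incl_equivalence :
  is_equivalence (loc_functor ge2_incl_weq : functor Ho_ge2 Ho_sc).
Proof.
exists (loc_functor reduce_weq); split.
  exact: loc_isomorphic_id reduce_ge2_incl.
exists (fun G => loc_in weq_sc (reduce_incl G) : @hom Ho_sc _ _); split; last first.
  by move=> G; apply: loc_in_invertible_W (reduce_incl_weq G).
apply: loc_natural => G H f /=.
apply: loc_trans (loc_sym (loc_in_cmp _ _ _)) _.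
apply: loc_trans (loc_in_cmp _ _ _); exact/loc_sym/reduce_incl_natural.
Qed.

(** * 1-reduced groupoids and chain complexes *)

Section ZmodOf.
Variables (T : Type) (zero : T) (opp : T -> T) (add : T -> T -> T).
Hypotheses (addA : associative add) (addC : commutative add).
Hypotheses (add0 : left_id zero add) (addN : left_inverse zero opp add).

(** The decidable equality and the choice structure that [zmodType] includes come from classical
    axioms. *)
Definition zmod_of : zmodType :=
  let C := HB.pack_for choiceType T (gen_eqMixin T) (gen_choiceMixin T) in
  HB.pack_for zmodType T (Choice.on C) (GRing.isZmodule.Build C addA addC add0 addN).
End ZmodOf.

(* On a 1-reduced groupoid, [comp 0] is total and makes the sets of cells of
   every dimension into abelian groups, in degrees 0 and 1 for trivial reasons. *)
Section OneReduced.
Variables (X : ocat) (Xgpd : is_groupoid X) (x0 : X 0).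
Hypotheses (eq0 : forall x y : X 0, x = y) (eq1 : forall u v : X 1, u = v).

Lemma composable0 n (v u : X n) : composable 0 v u.
Proof. exact: eq0. Qed.
Hint Resolve composable0 : core.

Lemma comp0A n : associative (@comp X n 0).
Proof. by case: n => [|n] u v w; [apply: eq0 | rewrite compA]. Qed.

(** Eckmann-Hilton: with only one object and one 1-arrow, any two cells satisfy the boundary
    conditions of [whisker_comm]. *)
Lemma comp0C n : commutative (@comp X n 0).
Proof.
case: n => [|[|n]] u v; [exact: eq0 | exact: eq1 |].
by apply: (@whisker_comm X n x0); first [exact: eq1 | exact: eq0].
Qed.

Lemma comp0z n : left_id (unts n x0) (@comp X n 0).
Proof.
case: n => [|n] u; first exact: eq0.
by apply: unit_comp; rewrite // (eq0 (tgts 0 u) x0).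
Qed.

Lemma comp0V n (u : X n) : exists v : X n, comp 0 v u = unts n x0.
Proof.
case: n u => [|n] u; first by exists u; apply: eq0.
have [v [_ _ _ vu]] := Xgpd u (ltn0Sn n).
by exists v; rewrite vu (eq0 (srcs 0 u) x0).
Qed.

Definition opp_cell n (u : X n) : X n := sval (cid (comp0V u)).

Lemma opp_cellP n : left_inverse (unts n x0) (@opp_cell n) (@comp X n 0).
Proof. by move=> u; apply: (svalP (cid (comp0V u))). Qed.

Definition cellz n : zmodType :=
  zmod_of (@comp0A n) (@comp0C n) (@comp0z n) (@opp_cellP n).

Local Open Scope ring_scope.

Lemma cell_addE n (u v : cellz n) : u + v = comp 0 (u : X n) v.
Proof. by []. Qed.

Lemma cell_0E n : (0 : cellz n) = unts n x0.
Proof. by []. Qed.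

Lemma src_additive n (u v : cellz n.+1) :
  src (u + v : cellz n.+1) = (src u : cellz n) + src v.
Proof. by case: n u v => [|n] u v; [apply: eq0 | rewrite !cell_addE src_comp]. Qed.

Lemma tgt_additive n (u v : cellz n.+1) :
  tgt (u + v : cellz n.+1) = (tgt u : cellz n) + tgt v.
Proof. by case: n u v => [|n] u v; [apply: eq0 | rewrite !cell_addE tgt_comp]. Qed.

Lemma unt_additive n (u v : cellz n) :
  unt (u + v : cellz n) = (unt u : cellz n.+1) + unt v.
Proof. by case: n u v => [|n] u v; [apply: eq1 | rewrite !cell_addE unt_comp]. Qed.

Lemma src0 n : src (0 : cellz n.+1) = (0 : cellz n).
Proof. by rewrite !cell_0E src_unts. Qed.

Lemma tgt0 n : tgt (0 : cellz n.+1) = (0 : cellz n).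
Proof. by rewrite !cell_0E tgt_unts. Qed.

Lemma unt0 n : unt (0 : cellz n) = (0 : cellz n.+1).
Proof. by rewrite !cell_0E unts_unt. Qed.

Lemma srcN n (u : cellz n.+1) : src (- u) = - (src u : cellz n) :> cellz n.
Proof. by apply: (@addrI _ (src u : cellz n)); rewrite -src_additive !subrr src0. Qed.

Lemma tgtN n (u : cellz n.+1) : tgt (- u) = - (tgt u : cellz n) :> cellz n.
Proof. by apply: (@addrI _ (tgt u : cellz n)); rewrite -tgt_additive !subrr tgt0. Qed.

Lemma untN n (u : cellz n) : unt (- u) = - (unt u : cellz n.+1) :> cellz n.+1.
Proof. by apply: (@addrI _ (unt u : cellz n.+1)); rewrite -unt_additive !subrr unt0. Qed.

Lemma srcs_additive n k (u v : cellz n) : (k <= n)%N ->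
  srcs k (u + v : cellz n) = (srcs k (u : X n) : cellz k) + srcs k (v : X n).
Proof. by case: k => [|k] kn; [apply: eq0 | rewrite cell_addE srcs_comp]. Qed.

(* Exchange law for [v = (v - e) + e] and [u = 0 + u], where [e] is the unit on
   the j-source of [v]. *)
Lemma comp_cellE n j (v u : cellz n) : (j < n)%N -> composable j (v : X n) u ->
  comp j (v : X n) u = v - (unts n (srcs j (v : X n)) : cellz n) + u :> cellz n.
Proof.
case: j => [|j] jn vu.
  by rewrite (eq0 (srcs 0 _) x0) -cell_0E subr0.
set e : cellz n := unts n (srcs j.+1 (v : X n)).
have srce : srcs j.+1 (e : X n) = srcs j.+1 (v : X n).
  by rewrite srcs_unts ?unts_id // ltnW.
have srcd : srcs j.+1 (v - e : cellz n) = (0 : cellz j.+1).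
  apply: (@addIr _ (srcs j.+1 (e : X n) : cellz j.+1)).
  by rewrite -srcs_additive 1?ltnW // subrK add0r srce.
have dz : comp j.+1 (v - e : cellz n) (0 : cellz n) = v - e :> X n.
  by apply: comp_unit => //; rewrite srcd !cell_0E unts_unts // ltnW.
have eu : comp j.+1 (e : X n) u = u.
  by apply: unit_comp => //; congr (unts n _).
rewrite -{1}[v](subrK e) -{1}[u]add0r !cell_addE -exchange ?dz ?eu //.
  apply/composableP; rewrite -cell_addE srcd !cell_0E tgts_unts // ltnW //.
by apply/composableP; rewrite srce.
Qed.

(** The kernel of the source map, since [unts n' x0] is the zero of [cellz n']; in degree 0 every
    cell is kept. *)
Definition is_normal n : X n -> Prop :=
  match n with 0 => fun _ => True | n'.+1 => fun u => src u = unts n' x0 end.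

Definition normal n : Type := {u : X n | is_normal u}.

Lemma normal_inj n (u v : normal n) : sval u = sval v -> u = v.
Proof.
by case: u v => [u pu] [v pv] /= uv; subst v; rewrite (Prop_irrelevance pu pv).
Qed.

Lemma is_normal0 n : is_normal (0 : cellz n).
Proof. by case: n => //= n; apply: src0. Qed.

Lemma is_normalD n (u v : cellz n) : is_normal u -> is_normal v -> is_normal (u + v : cellz n).
Proof.
case: n u v => //= n u v su sv.
by rewrite src_additive; move: su sv; rewrite -!cell_0E => -> ->; rewrite addr0.
Qed.

Lemma is_normalN n (u : cellz n) : is_normal u -> is_normal (- u : cellz n).
Proof.
by case: n u => //= n u su; rewrite srcN; move: su; rewrite -!cell_0E => ->; rewrite oppr0.
Qed.

Definition normal_zero n : normal n := exist _ (0 : cellz n) (is_normal0 n).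
Definition normal_opp n (u : normal n) : normal n :=
  exist _ (- (sval u : cellz n)) (is_normalN (proj2_sig u)).
Definition normal_add n (u v : normal n) : normal n :=
  exist _ ((sval u : cellz n) + sval v) (is_normalD (proj2_sig u) (proj2_sig v)).

Lemma normal_addA n : associative (@normal_add n).
Proof. by move=> u v w; apply: normal_inj; rewrite /= addrA. Qed.
Lemma normal_addC n : commutative (@normal_add n).
Proof. by move=> u v; apply: normal_inj; rewrite /= addrC. Qed.
Lemma normal_add0 n : left_id (@normal_zero n) (@normal_add n).
Proof. by move=> u; apply: normal_inj; rewrite /= add0r. Qed.
Lemma normal_addN n : left_inverse (@normal_zero n) (@normal_opp n) (@normal_add n).
Proof. by move=> u; apply: normal_inj; rewrite /= addNr. Qed.

Definition normalz n : zmodType :=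
  zmod_of (@normal_addA n) (@normal_addC n) (@normal_add0 n) (@normal_addN n).

Lemma is_normal_tgt n (u : X n.+1) : is_normal u -> is_normal (tgt u).
Proof. by case: n u => //= n u su; rewrite -src_src su src_unts. Qed.

Definition normal_bd n (u : normalz n.+1) : normalz n :=
  exist _ (tgt (sval u)) (is_normal_tgt (proj2_sig u)).

Lemma normal_bd_additive n : zmod_morphism (@normal_bd n).
Proof.
move=> u v; apply: normal_inj => /=.
by rewrite tgt_additive tgtN.
Qed.

HB.instance Definition _ n :=
  GRing.isZmodMorphism.Build (normalz n.+1) (normalz n) (@normal_bd n) (@normal_bd_additive n).

Lemma normal_bd_bd n (u : normalz n.+2) : normal_bd (normal_bd u) = 0.
Proof.
by apply: normal_inj; rewrite /= -tgt_src (proj2_sig u) tgt_unts.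
Qed.

Definition normal_complex : complex :=
  @Complex normalz (fun n => @normal_bd n : {additive normalz n.+1 -> normalz n})
    normal_bd_bd.

(** The splitting behind the equivalence: a cell is its normal part [u - unt (src u)] plus the unit
    on its source, and the source is decomposed in turn. *)
Fixpoint assemble n : Kcell normalz n -> X n :=
  match n with
  | 0 => fun a => sval a
  | n'.+1 => fun a => (sval a.1 : cellz n'.+1) + unt (@assemble n' a.2)
  end.

Lemma is_normal_part n (u : X n.+1) :
  is_normal ((u : cellz n.+1) - (unt (src u) : cellz n.+1) : cellz n.+1).
Proof. by rewrite /= src_additive srcN src_unt subrr. Qed.

Fixpoint disassemble n : X n -> Kcell normalz n :=
  match n with
  | 0 => fun u => exist _ u I
  | n'.+1 => fun u => (exist _ _ (is_normal_part u), @disassemble n' (src u))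
  end.

Lemma disassembleK n (u : X n) : assemble (disassemble u) = u.
Proof. by elim: n u => [|n IH] u //=; rewrite IH subrK. Qed.

Lemma src_assemble n (a : Kcell normalz n.+1) : src (assemble a) = assemble a.2.
Proof.
case: a => [[a na] y] /=; rewrite src_additive src_unt.
by rewrite (_ : src _ = (0 : cellz n)) ?add0r.
Qed.

Lemma assembleK n (a : Kcell normalz n) : disassemble (assemble a) = a.
Proof.
elim: n a => [|n IH] a; first exact: normal_inj.
have e : src (assemble a) = assemble a.2 by apply: src_assemble.
(* The normality proof mentions the source, so it is generalized before the source is rewritten. *)
rewrite [LHS]/=; move: (is_normal_part _); rewrite e IH /= addrK.
case: a {e} => [a y] pa; congr pair; exact: normal_inj.
Qed.

Lemma assemble_addtop n (b : normalz n) (y : Kcell normalz n) :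
  assemble (Kaddtop b y) = (sval b : cellz n) + assemble y.
Proof. by case: n b y => [|n] b y //=; rewrite addrA. Qed.

Lemma assemble_tgt n (a : Kcell normalz n.+1) :
  assemble (@Ktgt normal_complex _ a) = tgt (assemble a).
Proof. by rewrite assemble_addtop /= tgt_additive tgt_unt. Qed.

Lemma srcs_assemble n j (a : Kcell normalz n) : 
  srcs j (assemble a) = assemble (@srcs (UK_obj normal_complex) n j a).
Proof.
apply/esym/ofn_move => [i u|i u]; first by rewrite -src_assemble.
by rewrite /= add0r.
Qed.

Lemma tgts_assemble n j (a : Kcell normalz n) : 
  tgts j (assemble a) = assemble (@tgts (UK_obj normal_complex) n j a).
Proof.
apply/esym/ofn_move => [i u|i u]; first by rewrite -assemble_tgt.
by rewrite /= add0r.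
Qed.

(** The right side is the formula of [comp_cellE], so this yields compatibility with compositions.
    The bound includes [j = n], where [v] cancels against itself and both sides are the image of
    [u]. *)
Lemma assemble_comp n j (v u : Kcell normalz n) : (j <= n)%N ->
  srcs j (assemble v) = tgts j (assemble u) ->
  assemble (Kcomp j v u) =
  (assemble v : cellz n) - (unts n (srcs j (assemble v)) : cellz n) + assemble u.
Proof.
elim: n v u => [|n IH] v u.
  by case: j => // _ _; rewrite unts_id srcs_id subrr add0r.
rewrite leq_eqVlt => /predU1P[jn _|]; first subst j.
  by rewrite unts_id srcs_id subrr add0r Kcomp_low.
rewrite ltnS => jn vu; rewrite /= ltnS jn.
rewrite -srcs_src // src_assemble unts_unt //.
move: jn; rewrite leq_eqVlt => /predU1P[jn|jn].
  (* For the top composition the subtracted unit is exactly the lower part of [v], so only its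
     normal part remains. *)
  subst j; rewrite unts_id srcs_id Kcomp_low //= addrK.
  by rewrite addrA.
rewrite IH 1?ltnW //; last first.
  move: vu; rewrite -(@srcs_src _ n) 1?ltnW // -(@tgts_src _ n) //.
  by rewrite !src_assemble.
rewrite !unt_additive untN.
have shuffle (Z : zmodType) (a b c d e : Z) :
    a + b + (c - d + e) = a + c - d + (b + e).
  by rewrite !addrA [a + b + c]addrAC [_ + b - d]addrAC.
exact: (shuffle (cellz n.+1)).
Qed.

Definition assemble_ofun : ofun (UK_obj normal_complex) X.
Proof.
exists assemble.
- by move=> i u; rewrite src_assemble.
- by move=> i u; apply: assemble_tgt.
- by move=> i u; rewrite /= add0r.
- move=> i j v u ji vu.
  have vu' : srcs j (assemble v) = tgts j (assemble u).
    by rewrite srcs_assemble tgts_assemble [in LHS]vu.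
  by rewrite comp_cellE // -assemble_comp // ltnW.
Defined.

Lemma normal_complex_ge2 : in_degrees_ge2 normal_complex.
Proof.
by move=> [|[|n]] // _ x; apply: normal_inj; [apply: eq0 | apply: eq1].
Qed.

End OneReduced.

Local Open Scope ring_scope.

(** * Full faithfulness of [UK] in degrees at least 2 *)

Fixpoint Kzero (C : nat -> zmodType) n : Kcell C n :=
  match n with 0 => 0 | n'.+1 => (0, Kzero C n') end.

(** In positive degree these are the cells with zero source, a copy of the chains inside the
    cells. *)
Definition Ktop (C : nat -> zmodType) n (a : C n) : Kcell C n :=
  Kaddtop a (Kzero C n).

Definition Kfst (C : nat -> zmodType) n : Kcell C n -> C n :=
  match n with 0 => id | n'.+1 => fst end.

Lemma Kfst_addtop (C : nat -> zmodType) n (a : C n) (x : Kcell C n) :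
  Kfst (Kaddtop a x) = a + Kfst x.
Proof. by case: n a x. Qed.

Lemma Kfst_zero (C : nat -> zmodType) n : Kfst (Kzero C n) = 0.
Proof. by case: n. Qed.

Lemma Kcomp_zero (C : nat -> zmodType) n j (u : Kcell C n) :
  Kcomp j (Kzero C n) u = u.
Proof. by elim: n u => [|n IH] //= [a u]; rewrite IH add0r if_same. Qed.

Lemma Kmap_zero (C D : complex) (f : cmap C D) n :
  Kmap (fun n => f n) (Kzero C n) = Kzero D n.
Proof. by elim: n => [|n IH] /=; rewrite raddf0 // IH. Qed.

Section Lift.
Variables (C D : complex) (C0 : in_degrees_ge2 C) (D0 : in_degrees_ge2 D).
Variable phi : ofun (UK_obj C) (UK_obj D).

Lemma ofn_Kzero n : ofn phi (Kzero C n : UK_obj C n) = Kzero D n.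
Proof.
elim: n => [|n IH]; first exact: D0.
exact: etrans (ofn_unt phi (Kzero C n : UK_obj C n)) (congr1 unt IH).
Qed.

Definition lift_fun n (a : C n) : D n := Kfst (ofn phi (Ktop a : UK_obj C n)).

Lemma composable0_UK n (v u : UK_obj C n) : composable 0 v u.
Proof. by rewrite /composable -/(srcs _ _) (C0 _ (srcs 0 v)) // (C0 _ (tgts 0 u)). Qed.

(** Since degree 0 vanishes, all cells compose along objects, and that composition adds the
    components of positive degree: preserving it means being additive. *)
Lemma lift_funD n (a b : C n) : lift_fun (a + b) = lift_fun a + lift_fun b.
Proof.
case: n a b => [|n] a b; first by rewrite (D0 _ (lift_fun _)) // [RHS]D0.
have KzD : Kcomp 0 (Kzero C n) (Kzero C n) = Kzero C n.
  by elim: n {a b} => //= n ->; rewrite addr0.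
have -> : lift_fun (a + b) =
   Kfst (ofn phi (comp 0 (Ktop a : UK_obj C n.+1) (Ktop b))).
  by congr (Kfst (ofn phi _)); rewrite /comp /= KzD !addr0.
by rewrite ofn_comp //; apply: composable0_UK.
Qed.

Lemma lift_fun_additive n : zmod_morphism (@lift_fun n).
Proof.
by move=> a b; apply: (@addIr _ (lift_fun b)); rewrite -lift_funD !subrK.
Qed.

HB.instance Definition _ n :=
  GRing.isZmodMorphism.Build (C n) (D n) (@lift_fun n) (@lift_fun_additive n).

Lemma lift_fun_bd n (a : C n.+1) : lift_fun (bd a) = bd (lift_fun a).
Proof.
have e : Ktop (bd a) = tgt (Ktop a : UK_obj C n.+1).
  by rewrite /Ktop /= /Ktgt /= addr0.
rewrite /lift_fun e ofn_tgt [tgt _]/(Ktgt _) Kfst_addtop.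
have -> : (ofn phi (Ktop a : UK_obj C n.+1) : Kcell D n.+1).2 = Kzero D n.
  exact: etrans (esym (ofn_src phi (Ktop a : UK_obj C n.+1))) (ofn_Kzero n).
by rewrite Kfst_zero addr0.
Qed.

Definition lift_cmap : cmap C D :=
  @CMap C D (fun n => @lift_fun n : {additive C n -> D n}) lift_fun_bd.

Lemma ofn_Ktop n (a : C n) : ofn phi (Ktop a : UK_obj C n) = Ktop (lift_fun a).
Proof.
case: n a => [|n] a; first by rewrite [RHS]addr0.
apply: injective_projections; first by rewrite [RHS]addr0.
exact: etrans (esym (ofn_src phi (Ktop a : UK_obj C n.+1))) (ofn_Kzero n).
Qed.

Lemma lift_cmapE n (u : UK_obj C n) : ofn (UK_mor lift_cmap) u = ofn phi u.
Proof.
elim: n u => [|n IH] u; first by rewrite [LHS]D0 // [RHS]D0.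
(* Every cell is a top cell composed along objects with the unit on its source, so by induction the
   values on top cells determine [phi]. *)
have -> : u = comp 0 (Ktop u.1 : UK_obj C n.+1) (unt (u.2 : UK_obj C n)).
  case: u => a u; rewrite /comp /unt /= /Kunt /= !addr0; congr pair.
  exact/esym/Kcomp_zero.
rewrite !ofn_comp //; try exact: composable0_UK.
rewrite !ofn_unt IH ofn_Ktop; congr comp.
apply: injective_projections.
  exact: etrans (congr1 (@lift_fun n.+1) (addr0 _)) (esym (addr0 _)).
exact: Kmap_zero.
Qed.

End Lift.

Lemma UK_faithful (C D : Ch) (f g : hom C D) : heq (fmor UK f) (fmor UK g) -> heq f g.
Proof.
move=> fg n a.
have := congr1 (@Kfst (D : complex) n) (fg n (Ktop (a : (C : complex) n))).
by case: n a => [|n] a /=; rewrite !addr0.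
Qed.

(** * Normalization and the quasi-inverse of [UK] *)

Section Normalization.
Variable G : oGpd_ge2.

Definition ge2_base : ge2_ocat G 0 := sval (cid (proj1 (proj2_sig G))).

Definition normalization : Ch_ge2 :=
  exist _ (normal_complex (proj2_sig (sval G)) ge2_base (@ge2_eq0 G) (@ge2_eq1 G) : Ch)
    (@normal_complex_ge2 _ (proj2_sig (sval G)) ge2_base (@ge2_eq0 G) (@ge2_eq1 G)).

Definition from_normalization : hom (UK_ge2 normalization) G :=
  assemble_ofun (proj2_sig (sval G)) ge2_base (@ge2_eq0 G) (@ge2_eq1 G).

Definition to_normalization : hom G (UK_ge2 normalization) :=
  inverse_ofun
    (@assembleK _ (proj2_sig (sval G)) ge2_base (@ge2_eq0 G) (@ge2_eq1 G) :
       forall n u, _ (ofn from_normalization u) = u)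
    (@disassembleK _ (proj2_sig (sval G)) ge2_base (@ge2_eq0 G) (@ge2_eq1 G)).

End Normalization.

Lemma UK_ge2_quasi_inverse : exists E, quasi_inverse UK_ge2 E.
Proof.
pose lift (C D : Ch_ge2) (g : hom (UK_ge2 C) (UK_ge2 D)) : hom C D :=
  lift_cmap (proj2_sig C) (proj2_sig D) g.
exists (@inverse_functor _ _ UK_ge2 lift
  (fun C D g => lift_cmapE (proj2_sig C) (proj2_sig D) g)
  (fun C D f g => @UK_faithful (sval C) (sval D) f g)
  normalization from_normalization to_normalization
  (fun G => @disassembleK _ _ _ _ _)
  (fun G => @assembleK _ _ _ _ _)).
exact: inverse_functorP.
Qed.

(** * Homotopy groups of [UK C] and homology of [C] *)

Lemma loop_UK (C : complex) m (x : UK_obj C 0) (u : UK_obj C m.+1) :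
  is_loop x u <-> bd (u.1 : C m.+1) = 0 /\ u.2 = unts m x.
Proof.
split=> [[su tu]|[du su]].
  (* The target of a loop equals its source, while their top components differ by [bd u.1]. *)
  split=> //; have := congr1 (@Kfst C m) (etrans tu (esym su)).
  by rewrite Kfst_addtop => /(canRL (addrK _)); rewrite subrr.
by split=> //; rewrite /tgt /= /Ktgt du Kaddtop0 su.
Qed.

(** An arrow out of [u] has the form [(c, u)], and its target is [u] with [bd c] added to the top
    component. *)
Lemma homotopic_UK (C : complex) m (u v : UK_obj C m.+1) : u.2 = v.2 ->
  homotopic u v <-> exists c : C m.+2, v.1 - u.1 = bd c.
Proof.
move=> uv2; split=> [[[c w] [<- <-]]|[c vu]].
  by exists c; rewrite /tgt /src /= addrK.
exists (c, u : Kcell C m.+1); split=> //.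
by rewrite /tgt /= /Ktgt /= -vu subrK uv2; case: v {uv2 vu}.
Qed.

Lemma UK_weq (C D : complex) (f : cmap C D) : in_degrees_ge2 C -> in_degrees_ge2 D ->
  quasi_iso f <-> weq (UK_mor f).
Proof.
move=> C0 D0; split=> [qf|wf].
- split.
  + by move=> x y _; rewrite (C0 _ _ x) // (C0 _ _ y) //; apply: homotopic_refl.
  + by move=> y; exists 0; rewrite (D0 _ _ y) // [ofn _ _]D0 //; apply: homotopic_refl.
  + move=> m x u v /loop_UK[du u2] /loop_UK[dv v2].
    rewrite !homotopic_UK /= ?u2 ?v2 //.
    (* Loops of dimension [m.+1] match cycles of that degree. A homotopy from [u] to [v] bounds
       [v - u], whereas [homologous] bounds first minus second: hence the exchange of [u] and [v],
       and the sign of [c] below. *)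
    have [[_ inj _] _] := qf m.+1.
    by apply: (inj (exist _ v.1 dv) (exist _ u.1 du)).
  + move=> m x w /loop_UK[dw w2].
    have [[_ _ surj] _] := qf m.+1.
    have [[a da] [c /= aw]] := surj (exist _ w.1 dw).
    exists (a, unts m x : Kcell C m); first by apply/loop_UK.
    apply/homotopic_UK; first by rewrite w2 -ofn_unts.
    by exists (- c); rewrite raddfN -aw opprB.
- case=> [|m]; split=> //; first last.
  + by move=> x y; exists 0; rewrite raddf0 /= raddfD subrr.
  + split.
    * move=> [x dx] [y dy] [z /= xy]; exists (f _ z).
      by rewrite -cfn_bd -xy raddfB.
    * move=> [x dx] [y dy] /= fxy.
      (* A cycle [a] becomes a loop [(a, e)] at the object 0. *)
      pose e : Kcell C m := unts m (0 : UK_obj C 0).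
      have := @weq_inj _ _ _ wf m 0 (y, e) (x, e).
      rewrite !homotopic_UK //; apply => //; exact/loop_UK.
    * move=> [z dz].
      have f0 : ofn (UK_mor f) (0 : UK_obj C 0) = 0 :> D 0%N := raddf0 _.
      have [|u /loop_UK[du u2]] := @weq_surj _ _ _ wf m 0 (z, unts m (0 : UK_obj D 0) : Kcell D m).
        by rewrite f0; apply/loop_UK.
      rewrite homotopic_UK /=; last by rewrite u2 -f0 -ofn_unts.
      move=> [c zu]; exists (exist _ u.1 du), (- c).
      by rewrite raddfN -zu opprB.
  + by move=> x y; exists 0; rewrite raddf0 /= raddfD subrr.
  (* In degree 0 both complexes vanish. *)
  + split=> [x y _|x y _|z].
    * by exists 0; rewrite raddf0 (D0 _ _ (sval _)) // (D0 _ _ (sval _)) // subrr.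
    * by exists 0; rewrite raddf0 (C0 _ _ (sval _)) // (C0 _ _ (sval _)) // subrr.
    * exists (exist _ 0 I), 0; rewrite raddf0 (D0 _ _ (sval _)) //.
      by rewrite (D0 _ _ (sval _)) // subrr.
Qed.

Lemma UK_ge2_weqP (C D : Ch_ge2) (f : hom C D) :
  qis_ge2 f <-> weq_ge2 (fmor UK_ge2 f).
Proof.
apply: iff_trans (UK_weq f (proj2_sig C) (proj2_sig D)) _.
exact: iff_sym (@weqP (sval (UK_ge2 C)) (sval (UK_ge2 D)) (fmor UK_ge2 f)).
Qed.

(** The isomorphism [eta] makes [UK (E f)] conjugate to [f]. Isomorphisms are weak equivalences, so
    cancellation shows that [UK (E f)] is one, and [UK] reflects weak equivalences to
    quasi-isomorphisms. *)
Lemma weq_ge2_conj (E : functor oGpd_ge2 Ch_ge2) :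
  quasi_inverse UK_ge2 E -> preserves weq_ge2 qis_ge2 E.
Proof.
move=> [_ [eta [nat inv]]] G H f wf; apply/UK_ge2_weqP.
have wG := weak_equivalence_invertible (inv G : @invertible oGpd (sval _) (sval G) _).
have wH := weak_equivalence_invertible (inv H : @invertible oGpd (sval _) (sval H) _).
move: wf wG wH => /weqP wf /weqP wG /weqP wH.
apply/(@weqP (sval (UK_ge2 (E G))) (sval (UK_ge2 (E H)))).
apply: (weq_right_cancel wH).
by apply: weq_eq (weq_comp wG wf) => n u; exact: esym (nat _ _ f n u).
Qed.

Theorem mainTheorem1 :
  is_equivalence (loc_functor ge2_incl_weq : functor Ho_ge2 Ho_sc) /\
  (exists E : functor oGpd_ge2 Ch_ge2, quasi_inverse UK_ge2 E) /\
  (forall E : functor oGpd_ge2 Ch_ge2, quasi_inverse UK_ge2 E ->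
     exists E_weq : preserves weq_ge2 qis_ge2 E,
       is_equivalence (loc_functor E_weq : functor Ho_ge2 D_ge2)).
Proof.
split; first exact: ge2_incl_equivalence.
split; first exact: UK_ge2_quasi_inverse.
move=> E qE; exists (weq_ge2_conj qE).
(* Both [UK_ge2] and [E] respect the inverted classes, so the pair of quasi-inverse functors
   descends to the localizations. *)
have UKW : preserves qis_ge2 weq_ge2 UK_ge2 by move=> C D f /UK_ge2_weqP.
exists (loc_functor UKW); exact: loc_quasi_inverse (quasi_inverse_sym qE).
Qed.
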